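(* Let $n\ge1$. For each $\varepsilon>0$ there exists $\delta>0$ such that the following holds. Let $X$ be a metric space that is $(\delta,n)$-Reifenberg flat up to scale $s_0>0$, that is, $\xi_X(x,r)\le\delta$ for all $x\in X$ and $s_0<r<\infty$. Then, for each $x\in X$ and $r>0$ there exist a metric $\rho$ on $\mathbb R^n$ which is bi-Hölder equivalent to the Euclidean norm $|\cdot|$ on $\mathbb R^n$, and a map $\bar g:B_X(x,r)\to B_\rho(0,2r)$ such that $$|\rho(\bar g(y),\bar g(z))-d_X(y,z)|\le\varepsilon(d_X(y,z)+s_0)\quad\text{for all }y,z\in B_X(x,r)$$ and $$\sup_{u\in B_\rho(0,(1-\varepsilon)r)}\ \inf_{v\in\bar g(B_X(x,r))}\rho(u,v)\le\varepsilon s_0.$$ If additionally $X$ is Ahlfors $n$-regular, then $(\mathbb R^n,\rho)$ is Ahlfors $n$-regular with regularity constant depending on $n$ and the regularity constant for $X$.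
   Context: Balls $B_X(x,r)$, $B_\rho(0,r)$ are closed. $\xi_X$: for $x\in X$, $0<r<\infty$, a norm $\|\cdot\|$ on $\mathbb R^n$ and a map $\varphi:B_X(x,r)\to B_{\|\cdot\|}(0,r)$ put $\zeta_X(x,r,\|\cdot\|,\varphi)=\frac1r\sup_{y,z\in B(x,r)}|d(y,z)-\|\varphi(y)-\varphi(z)\||$, $\eta_X(x,r,\|\cdot\|,\varphi)=\frac1r\sup_{u\in B_{\|\cdot\|}(0,r)}\operatorname{dist}_{\|\cdot\|}(u,\varphi(B(x,r)))$, and $\xi_X(x,r)=\inf_{\|\cdot\|}\inf_\varphi(\zeta_X+\eta_X)$, the infimum over all norms on $\mathbb R^n$ and all such maps. Bi-Hölder: a map $f:Y\to Z$ between metric spaces is bi-Hölder with exponent $\alpha\in(0,1)$ if there is $C\ge1$ such that $C^{-1}d_Y(x,y)^{1/\alpha}\le d_Z(f(x),f(y))\le C\,d_Y(x,y)^{\alpha}$ for all $x,y\in Y$. Two metric spaces $Y,Z$ are bi-Hölder equivalent with exponent $\alpha$ if there is a surjective map $f:Y\to Z$ which is bi-Hölder with exponent $\alpha$. A metric $\rho$ on $\mathbb R^n$ is bi-Hölder equivalent to a norm if this holds, for some exponent $\alpha\in(0,1)$, for the metric spaces given by $\mathbb R^n$ with $\rho$ and $\mathbb R^n$ with the norm. $X$ is Ahlfors $n$-regular if there is $C_0\ge1$ (the regularity constant) with $C_0^{-1}r^n\le\mathcal H^n(B(x,r))\le C_0r^n$ for all $x\in X$, $0<r<\operatorname{diam}(X)$,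 with $\mathcal H^n$ the $n$-dimensional Hausdorff measure.
   Formalization: The printed bi-Hölder inequalities for all x,y force the space to be bounded, so no metric on R^n satisfies them; they are replaced by C^-1 min(d^(1/α),d^α) ≤ d' ≤ C max(d^(1/α),d^α), i.e. the two exponents are exchanged when d ≥ 1. *)

(* Defs.v *)
(* MathComp-Analysis. *)
From HB Require Import structures.
From mathcomp Require Import all_boot all_order all_algebra.
From mathcomp Require Import all_classical all_reals all_analysis.

Set Implicit Arguments.
Unset Strict Implicit.
Unset Printing Implicit Defensive.

Import Order.TTheory GRing.Theory Num.Theory.
Import numFieldNormedType.Exports.

Local Open Scope classical_set_scope.
Local Open Scope ring_scope.

(* Metric notions are relative to an explicit distance function, because 'rV_n
   is considered below with metrics other than that of its canonical structure,
   which comes from the sup norm. *)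
Section DistanceFunctions.
Context {R : realType} {T : Type}.
Implicit Types (d : T -> T -> R) (A : set T).

Definition is_metric d :=
  [/\ forall x y, 0 <= d x y,
      forall x y, d x y = 0 <-> x = y,
      forall x y, d x y = d y x &
      forall x y z, d x z <= d x y + d y z].

(* The library's [closed_ball] is the closure of the open ball, which can be
   strictly smaller than this set. *)
Definition cball d (x : T) (r : R) : set T := [set y | d x y <= r].

Definition set_dist d (u : T) A : \bar R := ereal_inf [set (d u v)%:E | v in A].

(* The supremum of the empty set is -oo, so the maximum with 0 makes the
   diameter of the empty set 0. *)
Definition diam d A : \bar R :=
  maxe 0%E (ereal_sup [set (d p.1 p.2)%:E | p in A `*` A]).

End DistanceFunctions.

(* Lebesgue measure of the Euclidean unit ball of R^n, by the recursion
   omega_n = (2 pi / n) omega_(n-2). *)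
Fixpoint unit_ball_volume (R : realType) (n : nat) : R :=
  match n with
  | 0%N => 1
  | 1%N => 2
  | (m.+1).+1 => 2 * pi / n%:R * unit_ball_volume R m
  end.

Section HausdorffMeasure.
Context {R : realType} {T : Type}.
Variables (d : T -> T -> R) (n : nat).

(* For n >= 1, which is the only case used, empty members of a covering
   contribute 0, so finite coverings are included. *)
Definition hausdorff_premeasure (t : R) (A : set T) : \bar R :=
  ereal_inf [set (\sum_(0 <= i <oo)
                    (unit_ball_volume R n / 2 ^+ n)%:E * diam d (F i) ^+ n)%E
    | F in [set F : nat -> set T |
        A `<=` \bigcup_i F i /\ forall i, (diam d (F i) <= t%:E)%E]].

Definition hausdorff_measure (A : set T) : \bar R :=
  ereal_sup [set hausdorff_premeasure t A | t in [set t : R | 0 < t]].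

Definition ahlfors_regular (C : R) :=
  1 <= C /\
  forall (x : T) (r : R), 0 < r -> (r%:E < diam d setT)%E ->
    ((C^-1 * r ^+ n)%:E <= hausdorff_measure (cball d x r))%E /\
    (hausdorff_measure (cball d x r) <= (C * r ^+ n)%:E)%E.

End HausdorffMeasure.

Section Norms.
Context {R : realType} {n : nat}.

Definition is_norm (N : 'rV[R]_n -> R) :=
  [/\ forall u, 0 <= N u,
      forall u, N u = 0 <-> u = 0,
      forall (a : R) u, N (a *: u) = `|a| * N u &
      forall u v, N (u + v) <= N u + N v].

Definition norm_dist (N : 'rV[R]_n -> R) (u v : 'rV[R]_n) : R := N (u - v).

Definition euclidean_norm (u : 'rV[R]_n) : R :=
  Num.sqrt (\sum_(i < n) u 0 i ^+ 2).

End Norms.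

Section ReifenbergFlatness.
Context {R : realType} (n : nat) {T : Type}.
Variable d : T -> T -> R.

(* Maps B(x,r) -> B_N(0,r) are represented by maps phi on all of T that send
   the first ball into the second; zeta and eta only depend on phi restricted
   to B(x,r). *)
Definition zeta (x : T) (r : R) (N : 'rV[R]_n -> R) (phi : T -> 'rV[R]_n)
    : \bar R :=
  ((r^-1)%:E *
   ereal_sup [set (`|d p.1 p.2 - norm_dist N (phi p.1) (phi p.2)|)%:E
             | p in cball d x r `*` cball d x r])%E.

Definition eta (x : T) (r : R) (N : 'rV[R]_n -> R) (phi : T -> 'rV[R]_n)
    : \bar R :=
  ((r^-1)%:E *
   ereal_sup [set set_dist (norm_dist N) u (phi @` cball d x r)
             | u in cball (norm_dist N) 0%R r])%E.

Definition xi (x : T) (r : R) : \bar R :=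
  ereal_inf [set ereal_inf [set (zeta x r N phi + eta x r N phi)%E
                           | phi in [set phi : T -> 'rV[R]_n |
                               set_fun (cball d x r)
                                       (cball (norm_dist N) 0 r) phi]]
            | N in [set N : 'rV[R]_n -> R | is_norm N]].

Definition reifenberg_flat (delta s0 : R) :=
  forall (x : T) (r : R), s0 < r -> (xi x r <= delta%:E)%E.

End ReifenbergFlatness.

Section BiHolder.
Context {R : realType} {Y Z : Type}.
Variables (dY : Y -> Y -> R) (dZ : Z -> Z -> R).

(* For dY x y <= 1 this reads
     C^-1 * dY x y `^ (1/a) <= dZ (f x) (f y) <= C * dY x y `^ a,
   and for dY x y >= 1 the two exponents are exchanged.  When dY is bounded it
   is equivalent, up to the value of C, to requiring the displayed inequalities
   for all x and y.  That requirement itself makes dY bounded, since it implies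
   dY x y `^ (1/a - a) <= C^2 with 1/a > a, so no surjection onto a nonzero
   normed space satisfies it. *)
Definition bi_holder (a : R) (f : Y -> Z) :=
  exists2 C : R, 1 <= C & forall x y,
    C^-1 * Num.min (dY x y `^ a^-1) (dY x y `^ a) <= dZ (f x) (f y) /\
    dZ (f x) (f y) <= C * Num.max (dY x y `^ a^-1) (dY x y `^ a).

Definition bi_holder_equivalent (a : R) :=
  exists2 f : Y -> Z, (forall z, exists y, f y = z) & bi_holder a f.

End BiHolder.

Definition bi_holder_equivalent_to_norm (R : realType) (n : nat)
    (rho : 'rV[R]_n -> 'rV[R]_n -> R) (N : 'rV[R]_n -> R) :=
  exists2 a : R, 0 < a < 1 & bi_holder_equivalent rho (norm_dist N) a.

(* Main.v *)
Require Import Defs.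
From HB Require Import structures.
From mathcomp Require Import all_boot all_order all_algebra.
From mathcomp Require Import all_classical all_reals all_analysis.
From mathcomp Require Import ring lra zify.
Set Implicit Arguments.
Unset Strict Implicit.
Unset Printing Implicit Defensive.
Import Order.TTheory GRing.Theory Num.Theory.
Import numFieldNormedType.Exports.
Local Open Scope classical_set_scope.
Local Open Scope ring_scope.

(* The bi-Hoelder constant of rho may depend on X, s0, x and r, so rho does not
   have to come from a parametrization of X: a thin tube winding through a net
   of X suffices.  Let b be a small multiple of s0.  Flatness gives approximate
   midpoints at all scales >= b, hence a finite 3b-separated net F of a connected
   neighbourhood of B(x,r) and a walk w_0, ..., w_m through F with steps <= 10b,
   starting near x, ending outside B(x,r), and visiting each point of F boundedly
   often, in terms of the degrees of the net.  Equip R^n with the metric of a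
   bottle: a cubical cap, a cylinder of radius 10b and length 10bm, then a flat
   end.  Marks a_i are placed along the cylinder with spacing 10b, and the
   shortcuts from a_i to a_j of length 10b + d(w_i, w_j) are glued in.  The
   resulting metric rho is bi-Lipschitz to the Euclidean one, a_i |-> w_i is an
   isometry up to O(b), and the flat end only meets B_rho(0,s) for s > r.  At
   scales below 10b the metric rho is locally that of the bottle, which is
   n-regular; above, the measure of a ball is b^n times a number of points of F,
   so that it is controlled by the regularity of X.  For the lower bound F has to
   be a net of a domain of John type, which contains balls of comparable size
   near each of its points at each scale. *)

Lemma expe_le (R : realDomainType) (x y : \bar R) (n : nat) :
  (0 <= x)%E -> (x <= y)%E -> (x ^+ n <= y ^+ n)%E.
Proof.
move=> x0 xy; elim: n => [|n IH]; first by rewrite !expe0.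
by rewrite !expeS; apply: lee_pmul => //; exact: expe_ge0.
Qed.

Lemma unit_ball_volume_gt0 (R : realType) (n : nat) : 0 < unit_ball_volume R n.
Proof.
(* The recursion has step two, so two consecutive values are carried along. *)
suff: 0 < unit_ball_volume R n /\ 0 < unit_ball_volume R n.+1 by case.
elim: n => [|n [IH1 IH2]]; first by split=> //=; lra.
split=> //; rewrite /= mulr_gt0// divr_gt0// mulr_gt0//.
exact: pi_gt0.
Qed.

Lemma nneseries_le_bound (R : realType) (u : nat -> \bar R) (M : \bar R) :
  (forall i, (0 <= u i)%E) -> (forall k, (\sum_(0 <= i < k) u i <= M)%E) ->
  (\sum_(0 <= i <oo) u i <= M)%E.
Proof.
move=> u0 uM; apply: lime_le; first by apply: is_cvg_nneseries => i _ _.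
by apply: nearW => k; exact: uM.
Qed.

(** Merges two coverings indexed by [nat] into one, by parity; subadditivity rests on it. *)
Lemma nneseries_interleave (R : realType) (u v : nat -> \bar R) :
  (forall i, (0 <= u i)%E) -> (forall i, (0 <= v i)%E) ->
  (\sum_(0 <= i <oo) (if odd i then v i./2 else u i./2) <=
   \sum_(0 <= i <oo) u i + \sum_(0 <= i <oo) v i)%E.
Proof.
move=> u0 v0; apply: nneseries_le_bound => [i|k]; first by case: ifP.
have w0 i : (0 <= if odd i then v i./2 else u i./2)%E by case: ifP.
have double m : (\sum_(0 <= i < m.*2) (if odd i then v i./2 else u i./2) =
    \sum_(0 <= i < m) u i + \sum_(0 <= i < m) v i)%E.
  elim: m => [|m IH]; first by rewrite !big_geq// adde0.
  rewrite doubleS !big_nat_recr//= IH odd_double/= uphalf_double doubleK.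
  by rewrite !addeA; congr (_ + _)%E; rewrite addeAC.
apply: (@le_trans _ _ (\sum_(0 <= i < k.*2) (if odd i then v i./2 else u i./2))%E).
  rewrite (@big_cat_nat _ _ _ k 0 k.*2)//=; last by rewrite -addnn leq_addr.
  by rewrite leeDl// sume_ge0.
rewrite double; apply: leeD; apply: nneseries_lim_ge => //.
Qed.

(** * Hausdorff measure *)

Section Hausdorff.
Context {R : realType} {T : Type}.
Variables (d : T -> T -> R) (n : nat).
Hypothesis n_gt0 : (0 < n)%N.
Implicit Types (A B : set T) (F G : nat -> set T).

Local Notation cn := (unit_ball_volume R n / 2 ^+ n).
Local Notation H := (hausdorff_measure d n).
Local Notation Hp := (hausdorff_premeasure d n).

Lemma cn_gt0 : 0 < cn.
Proof. by rewrite divr_gt0// ?unit_ball_volume_gt0// exprn_gt0. Qed.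

Lemma diam_ge0 A : (0 <= diam d A)%E.
Proof. by rewrite /diam le_max lexx. Qed.

Lemma diam_leP A (D : R) : 0 <= D ->
  (diam d A <= D%:E)%E <-> forall x y, A x -> A y -> d x y <= D.
Proof.
move=> D0; rewrite /diam ge_max lee_fin D0/=; split.
  move=> AD x y Ax Ay; rewrite -lee_fin; apply: le_trans AD.
  by apply: ereal_sup_ubound; exists (x, y).
move=> AD; apply: ge_ereal_sup => _ [[x y] [/= Ax Ay] <-].
by rewrite lee_fin; exact: AD.
Qed.

Lemma diam_set0 : diam d set0 = 0%E.
Proof.
apply/eqP; rewrite eq_le diam_ge0 andbT.
by apply/diam_leP.
Qed.

Lemma diam_term_ge0 A : (0 <= cn%:E * diam d A ^+ n)%E.
Proof. by rewrite mule_ge0// ?lee_fin ?(ltW cn_gt0)// expe_ge0// diam_ge0. Qed.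
Local Hint Resolve diam_term_ge0 : core.

Lemma diam_term_set0 : (cn%:E * diam d set0 ^+ n = 0)%E.
Proof.
by rewrite diam_set0 -[0%E]/(0%:E) -EFin_expe expr0n eqn0Ngt n_gt0/= mule0.
Qed.

Lemma hausdorff_premeasure_ge0 t A : (0 <= Hp t A)%E.
Proof.
by apply: le_ereal_inf_tmp => _ [F _ <-]; exact: nneseries_ge0.
Qed.

Lemma hausdorff_ge0 A : (0 <= H A)%E.
Proof.
apply: le_trans (hausdorff_premeasure_ge0 1 A) _.
by apply: ereal_sup_ubound; exists 1 => //; exact: ltr01.
Qed.

Lemma hausdorff_premeasure_le t A : 0 < t -> (Hp t A <= H A)%E.
Proof. by move=> t0; apply: ereal_sup_ubound; exists t. Qed.

Lemma hausdorff_premeasure_anti s t A : s <= t -> (Hp t A <= Hp s A)%E.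
Proof.
move=> st; apply: ereal_inf_le_tmp => _ [F [AF Fs] <-]; exists F => //.
by split=> // i; apply: le_trans (Fs i) _; rewrite lee_fin.
Qed.

Lemma hausdorff_premeasure_mono t A B : A `<=` B -> (Hp t A <= Hp t B)%E.
Proof.
move=> AB; apply: ereal_inf_le_tmp => _ [F [BF Ft] <-]; exists F => //.
by split=> //; exact: subset_trans BF.
Qed.

Lemma hausdorff_mono A B : A `<=` B -> (H A <= H B)%E.
Proof.
move=> AB; apply: ge_ereal_sup => _ [t t0 <-].
exact: le_trans (hausdorff_premeasure_mono t AB) (hausdorff_premeasure_le _ t0).
Qed.

Lemma hausdorff_setU A B : (H (A `|` B) <= H A + H B)%E.
Proof.
apply: ge_ereal_sup => _ [t t0 <-].
apply: le_trans (leeD (hausdorff_premeasure_le A t0) (hausdorff_premeasure_le B t0)).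
have PA := hausdorff_premeasure_ge0 t A; have PB := hausdorff_premeasure_ge0 t B.
(* Coverings within [e / 2] of the infimum exist only when the infimum is finite. *)
have [->|Ay] := eqVneq (Hp t A) +oo%E.
  by rewrite addye ?leey// -ltNye (lt_le_trans _ PB).
have [->|By] := eqVneq (Hp t B) +oo%E.
  by rewrite addey ?leey// -ltNye (lt_le_trans _ PA).
have Af : Hp t A \is a fin_num by rewrite ge0_fin_numE// lt_neqAle Ay leey.
have Bf : Hp t B \is a fin_num by rewrite ge0_fin_numE// lt_neqAle By leey.
apply/lee_addgt0Pr => e e0.
have e20 : 0 < e / 2 by rewrite divr_gt0.
have [_ [F [AF Ft] <-] Fe] := lb_ereal_inf_adherent e20 Af.
have [_ [G [BG Gt] <-] Ge] := lb_ereal_inf_adherent e20 Bf.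
have -> : (Hp t A + Hp t B + e%:E = (Hp t A + (e/2)%:E) + (Hp t B + (e/2)%:E))%E.
  by rewrite addeACA -EFinD -splitr.
apply: le_trans (leeD (ltW Fe) (ltW Ge)).
apply: le_trans (nneseries_interleave _ _) => //.
apply: ge_ereal_inf; exists
  (\sum_(0 <= i <oo) cn%:E * diam d (if odd i then G i./2 else F i./2) ^+ n)%E.
  exists (fun i => if odd i then G i./2 else F i./2) => //; split.
    move=> z [/AF[i _ Fi]|/BG[i _ Gi]].
      by exists i.*2 => //=; rewrite odd_double doubleK.
    by exists i.*2.+1 => //=; rewrite odd_double/= uphalf_double.
  by move=> i; case: ifP.
by apply: lee_nneseries => // i _; case: ifP.
Qed.

Lemma hausdorff_set0 : H set0 = 0%E.
Proof.
apply/eqP; rewrite eq_le hausdorff_ge0 andbT.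
apply: ge_ereal_sup => _ [t t0 <-]; apply: ge_ereal_inf.
exists (\sum_(0 <= i <oo) cn%:E * diam d set0 ^+ n)%E; last first.
  by rewrite eseries0// => i _ _; exact: diam_term_set0.
exists (fun=> set0) => //; split=> // i.
by rewrite diam_set0 lee_fin ltW.
Qed.

Lemma hausdorff_bigcup_seq (I : eqType) (s : seq I) (A : I -> set T) (B : set T) (M : R) :
  (forall z, B z -> exists2 i, i \in s & A i z) ->
  (forall i, i \in s -> (H (A i) <= M%:E)%E) ->
  (H B <= ((size s)%:R * M)%:E)%E.
Proof.
elim: s B => [|i s IH] B Bs sM.
  rewrite mul0r (_ : B = set0) ?hausdorff_set0// -subset0 => z /Bs[].
  by move=> ?; rewrite in_nil.
apply: (@le_trans _ _ (H (A i `|` (B `\` A i)))).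
  by apply: hausdorff_mono => z Bz; have [|] := pselect (A i z); [left|right].
apply: le_trans (hausdorff_setU _ _) _.
rewrite /= -natr1 mulrDl mul1r [X in (_ <= X%:E)%E]addrC EFinD; apply: leeD.
  by apply: sM; rewrite mem_head.
apply: IH => [z [/Bs[j]]|j js].
  rewrite in_cons => /predU1P[->//|js Aj _]; by exists j.
by apply: sM; rewrite in_cons js orbT.
Qed.

(** Upper bounds come from finite coverings by sets of a common size [h]. They are padded with empty
    sets, whose terms vanish because [n] is positive. *)
Lemma hausdorff_le_cover A (M h0 : R) : 0 < h0 ->
  (forall h, 0 < h -> h <= h0 -> exists N F,
    [/\ forall z, A z -> exists2 i, (i < N)%N & F i z,
        forall i, (i < N)%N -> (diam d (F i) <= h%:E)%E & N%:R * h ^+ n <= M]) ->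
  (H A <= (cn * M)%:E)%E.
Proof.
move=> h00 AM; apply: ge_ereal_sup => _ [s /= s0 <-].
set t := Num.min s h0.
have t0 : 0 < t by rewrite lt_min s0.
have [N [F [AF Ft NM]]] := AM t t0 ltac:(by rewrite ge_min lexx orbT).
apply: (@le_trans _ _ (Hp t A)); first by apply: hausdorff_premeasure_anti; rewrite ge_min lexx.
apply: ge_ereal_inf.
pose F' i := if (i < N)%N then F i else set0.
exists (\sum_(0 <= i <oo) cn%:E * diam d (F' i) ^+ n)%E.
  exists F' => //; split.
    by move=> z /AF[i iN Fi]; exists i => //; rewrite /F' iN.
  by move=> i; rewrite /F'; case: ifP => [/Ft//|_]; rewrite diam_set0 lee_fin ltW.
apply: nneseries_le_bound => // k.
apply: (@le_trans _ _ (cn * (N%:R * t ^+ n))%:E); last first.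
  by rewrite lee_fin ler_pM2l// cn_gt0.
have b0 : 0 <= cn * t ^+ n by rewrite mulr_ge0 ?(ltW cn_gt0)// exprn_ge0// ltW.
have bnd : (\sum_(0 <= i < k) cn%:E * diam d (F' i) ^+ n <=
    ((minn k N)%:R * (cn * t ^+ n))%:E)%E.
  elim: k => [|k IH]; first by rewrite big_geq// min0n mul0r.
  rewrite big_nat_recr//=; rewrite {2}/F'; case: ltnP => kN.
    move: IH; rewrite (minn_idPl (ltnW kN)) (minn_idPl kN) => IH.
    rewrite -[k.+1%:R]natr1 mulrDl mul1r EFinD; apply: leeD => //.
    rewrite [leRHS]EFinM; apply: lee_pmul => //.
    - by rewrite lee_fin (ltW cn_gt0).
    - by rewrite expe_ge0// diam_ge0.
    - by rewrite EFin_expe; apply: expe_le; [exact: diam_ge0|exact: Ft].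
  by rewrite diam_term_set0 adde0 (minn_idPr (leqW kN)); move: IH; rewrite (minn_idPr kN).
apply: le_trans bnd _; rewrite lee_fin mulrCA ler_wpM2l ?(ltW cn_gt0)//.
by rewrite ler_wpM2r ?exprn_ge0 ?(ltW t0)// ler_nat geq_minr.
Qed.

(** The Caratheodory property of a metric outer measure: a set of diameter below [h] cannot meet
    both [A] and [B], so a fine covering of the union splits into a covering of each. *)
Lemma hausdorff_separated A B (h : R) : 0 < h ->
  (forall x y, A x -> B y -> h <= d x y) -> (H A + H B <= H (A `|` B))%E.
Proof.
move=> h0 AB.
have key t : 0 < t -> t < h -> (Hp t A + Hp t B <= H (A `|` B))%E.
  move=> t0 th; apply: le_trans (hausdorff_premeasure_le _ t0).
  apply: le_ereal_inf_tmp => _ [F [ABF Ft] <-].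
  pose FA i := if `[< F i `&` A !=set0 >] then F i else set0.
  pose FB i := if `[< F i `&` B !=set0 >] then F i else set0.
  have term_ge0 i : (0 <= cn%:E * diam d (F i) ^+ n)%E by [].
  apply: (@le_trans _ _ (\sum_(0 <= i <oo) cn%:E * diam d (FA i) ^+ n +
                         \sum_(0 <= i <oo) cn%:E * diam d (FB i) ^+ n)%E).
    apply: leeD; apply: ereal_inf_lbound.
      exists FA => //; split=> [z Az|i].
        have [i _ Fi] := ABF z (or_introl Az); exists i => //.
        by rewrite /FA asboolT//; exists z.
      by rewrite /FA; case: ifP => _ //; rewrite diam_set0 lee_fin ltW.
    exists FB => //; split=> [z Bz|i].
      have [i _ Fi] := ABF z (or_intror Bz); exists i => //.
      by rewrite /FB asboolT//; exists z.
    by rewrite /FB; case: ifP => _ //; rewrite diam_set0 lee_fin ltW.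
  rewrite -nneseriesD//; apply: lee_nneseries => i _; first by rewrite adde_ge0.
  rewrite /FA /FB; case: ifPn => [/asboolP[x [Fx Ax]]|_]; last first.
    by rewrite diam_term_set0 add0e; case: ifP => // _; rewrite diam_term_set0.
  case: ifPn => [/asboolP[y [Fy By]]|_]; last by rewrite diam_term_set0 adde0.
  have /diam_leP := Ft i; move=> /(_ (ltW t0)) /(_ x y Fx Fy).
  by rewrite leNgt (lt_le_trans th (AB _ _ Ax By)).
have hp s : 0 < s -> 0 < Num.min s (h / 2) by move=> s0; rewrite lt_min s0/= divr_gt0.
have hlt s : Num.min s (h / 2) < h.
  by rewrite gt_min [X in _ || X]ltr_pdivrMr// ltr_pMr// [1 < 2]ltr1n orbT.
(* The two suprema are taken one after the other, which needs finite values to subtract; [key] is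
   then used at a scale below both [s] and [t]. *)
have [->|yAB] := eqVneq (H (A `|` B)) +oo%E; first by rewrite leey.
have ABf : H (A `|` B) \is a fin_num by rewrite ge0_fin_numE ?hausdorff_ge0// lt_neqAle yAB leey.
have Bf : H B \is a fin_num.
  rewrite ge0_fin_numE ?hausdorff_ge0//; apply: le_lt_trans (hausdorff_mono (@subsetUr _ A B)) _.
  by rewrite lt_neqAle yAB leey.
rewrite -leeBrDr//; apply: ge_ereal_sup => _ [s s0 <-].
rewrite leeBrDr// addeC.
have Af : Hp s A \is a fin_num.
  rewrite ge0_fin_numE ?hausdorff_premeasure_ge0//.
  apply: le_lt_trans (hausdorff_premeasure_le _ s0) _.
  apply: le_lt_trans (hausdorff_mono (@subsetUl _ A B)) _.
  by rewrite lt_neqAle yAB leey.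
rewrite -leeBrDr//; apply: ge_ereal_sup => _ [t t0 <-].
rewrite leeBrDr//.
set r := Num.min (Num.min s t) (h / 2).
have st0 : 0 < Num.min s t by rewrite lt_min s0.
have rs : r <= s by rewrite !ge_min lexx.
have rt : r <= t by rewrite !ge_min lexx orbT.
rewrite addeC; apply: le_trans (key r (hp _ st0) (hlt _)).
by apply: leeD; exact: hausdorff_premeasure_anti.
Qed.

Lemma hausdorff_separated_seq (I : eqType) (s : seq I) (A : I -> set T) B (h m : R) :
  uniq s -> 0 < h ->
  (forall i j x y, i \in s -> j \in s -> i != j -> A i x -> A j y -> h <= d x y) ->
  (forall i, i \in s -> A i `<=` B) ->
  (forall i, i \in s -> (m%:E <= H (A i))%E) ->
  (((size s)%:R * m)%:E <= H B)%E.
Proof.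
move=> + h0; elim: s B => [|i s IH] B /=; first by rewrite mul0r hausdorff_ge0.
move=> /andP[i_s us] sep AB mA.
have ii : i \in i :: s by rewrite mem_head.
have is_ j : j \in s -> j \in i :: s by rewrite in_cons orbC => ->.
pose B' := [set z | exists2 j, j \in s & A j z].
apply: (@le_trans _ _ (H (A i `|` B'))); last first.
  apply: hausdorff_mono => z [Az|[j js Aj]]; first exact: AB Az.
  exact: (AB j (is_ j js)).
apply: le_trans (hausdorff_separated h0 _); last first.
  move=> x y Ax [j js Aj]; apply: (sep i j) => //; first exact: is_.
  by apply: contraNneq i_s => ->.
rewrite -natr1 mulrDl mul1r [X in (X%:E <= _)%E]addrC EFinD; apply: leeD; first exact: mA.
apply: IH => //.
- by move=> j k x y js ks; apply: sep; exact: is_.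
- by move=> j js z Aj; exists j.
- by move=> j js; apply: mA; exact: is_.
Qed.

End Hausdorff.

(** * Cubes in the sup norm and the lower bound for Hausdorff measure *)

Lemma rV_norm_leP (R : realType) (n : nat) (u : 'rV[R]_n) (t : R) : 0 <= t ->
  `|u| <= t <-> forall j, `|u 0 j| <= t.
Proof.
move=> t0; rewrite [`|u|]mx_normrE; split.
  by move=> /bigmax_leP[_ h] j; exact: (h (0, j)).
by move=> h; apply/bigmax_leP; split=> // -[i j] _ /=; rewrite ord1; exact: h.
Qed.

Lemma rV_coord_le_norm (R : realType) (n : nat) (u : 'rV[R]_n) j : `|u 0 j| <= `|u|.
Proof. exact: (rV_norm_leP u (normr_ge0 u)).1. Qed.

Lemma rV_norm_coord (R : realType) (n : nat) (u : 'rV[R]_n.+1) : exists j, `|u| = `|u 0 j|.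
Proof.
have [->|u0] := eqVneq u 0; first by exists ord0; rewrite mxE !normr0.
have [|[i j]] := @mx_norm_neq0 R 1 n.+1 u.
  by apply: contra_neq u0 => h; apply/eqP; rewrite -normr_eq0; apply/eqP.
by rewrite /= ord1 => h; exists j.
Qed.

Definition cube (R : realType) (n : nat) (c : 'rV[R]_n) (a : R) : set 'rV[R]_n :=
  [set u | forall j, c 0 j <= u 0 j <= c 0 j + a].

(** Two grid points in [E] have indices differing by at most [D * N / a] in each coordinate, so all
    indices lie in a window of [2 * q + 1] values around those of one fixed point [k0]. *)
Lemma grid_count (R : realType) (n : nat) (c : 'rV[R]_n) (a D : R) (N : nat)
    (E : set 'rV[R]_n) :
  0 < a -> 0 <= D -> (0 < N)%N -> (forall u v, E u -> E v -> `|u - v| <= D) ->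
  (#|[set k : {ffun 'I_n -> 'I_N} |
      `[< E (\row_j (c 0 j + a * (k j)%:R / N%:R)) >]]%SET|%:R : R) <=
  (2 * (D * N%:R / a) + 1) ^+ n.
Proof.
move=> a0 D0 N0 ED; set K := [set k | _]%SET.
have N0' : 0 < N%:R :> R by rewrite ltr0n.
have q0 : 0 <= D * N%:R / a by rewrite divr_ge0 ?mulr_ge0 ?(ltW a0) ?(ltW N0').
have [->|/set0Pn[k0 k0K]] := eqVneq K finset.set0.
  by rewrite cards0 exprn_ge0// addr_ge0// mulr_ge0.
set q := Num.truncn (D * N%:R / a).
have near_k0 (k : {ffun 'I_n -> 'I_N}) j : k \in K -> (k j <= k0 j + q)%N /\ (k0 j <= k j + q)%N.
  rewrite inE => /asboolP Ek; move: k0K; rewrite inE => /asboolP Ek0.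
  have := ED _ _ Ek Ek0; move=> /(rV_norm_leP _ D0)/(_ j); rewrite !mxE.
  have -> : c 0 j + a * (k j)%:R / N%:R - (c 0 j + a * (k0 j)%:R / N%:R) =
            (a / N%:R) * ((k j)%:R - (k0 j)%:R) by field; rewrite lt0r_neq0.
  rewrite normrM gtr0_norm ?divr_gt0// mulrC -ler_pdivlMr ?divr_gt0// invf_div mulrA.
  rewrite ler_norml => /andP[h1 h2].
  have hq : D * N%:R / a < q.+1%:R by exact: truncnS_gt.
  have h2' : (k j)%:R < (k0 j + q.+1)%:R :> R by rewrite natrD; lra.
  have h1' : (k0 j)%:R < (k j + q.+1)%:R :> R by rewrite natrD; lra.
  by move: h1' h2'; rewrite !ltr_nat !addnS !ltnS.
pose f (k : {ffun 'I_n -> 'I_N}) : {ffun 'I_n -> 'I_(2 * q).+1} :=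
  [ffun j => inord (k j + q - k0 j)].
have f_inj : {in K &, injective f}.
  move=> k k' kK k'K /ffunP fkk'; apply/ffunP => j; apply: val_inj => /=.
  have [k1 k2] := near_k0 k j kK; have [k1' k2'] := near_k0 k' j k'K.
  have := fkk' j; rewrite !ffunE => /(congr1 val); rewrite /= !inordK.
  - move=> h; apply/eqP; rewrite -(eqn_add2r q); apply/eqP.
    by rewrite -(subnK k2) -(subnK k2') h.
  - by rewrite ltnS leq_subLR mul2n -addnn addnA leq_add2r.
  - by rewrite ltnS leq_subLR mul2n -addnn addnA leq_add2r.
rewrite -(card_in_imset f_inj).
apply: (@le_trans _ _ (((2 * q).+1 ^ n)%N%:R)).
  rewrite ler_nat; apply: leq_trans (max_card _) _.
  by rewrite card_ffun !card_ord.
rewrite natrX lerXn2r ?nnegrE ?ler0n//.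
  by rewrite addr_ge0// mulr_ge0.
rewrite -natr1 natrM lerD2r ler_pM2l//.
by rewrite truncn_le.
Qed.

Lemma cube_compact (R : realType) (n : nat) (c : 'rV[R]_n) (a : R) : compact (cube c a).
Proof.
rewrite (_ : cube c a = [set u | forall j, `[c 0 j, c 0 j + a]%classic (u ord0 j)]).
  by apply: (@rV_compact R^o n (fun j => `[c 0 j, c 0 j + a]%classic)) => j; exact: segment_compact.
by apply/seteqP; split=> u h j; have := h j; rewrite /= in_itv.
Qed.

Lemma sum_geometric_half (R : realFieldType) (e : R) (k : nat) : 0 <= e ->
  \sum_(0 <= i < k) e / 2 ^+ i.+1 <= e.
Proof.
move=> e0; suff -> : \sum_(0 <= i < k) e / 2 ^+ i.+1 = e - e / 2 ^+ k.
  by rewrite gerBl divr_ge0// exprn_ge0.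
elim: k => [|k IH]; first by rewrite big_geq// expr0 divr1 subrr.
rewrite big_nat_recr//= IH exprS; have : (2 : R) ^+ k != 0 by rewrite expf_neq0.
by move=> h; field.
Qed.

(* Each set [E i] contains at most [(const * D i * N / a + 1) ^+ n] of the
   [N ^ n] points of a regular grid in the cube; compactness makes the
   covering finite before [N] is chosen. *)
Lemma cube_cover (R : realType) (n : nat) (c : 'rV[R]_n) (a : R) (E : nat -> set 'rV[R]_n)
    (D : nat -> R) :
  (0 < n)%N -> 0 < a -> (forall i, 0 <= D i) ->
  (forall i u v, E i u -> E i v -> `|u - v| <= D i) ->
  cube c a `<=` \bigcup_i E i ->
  ((a ^+ n)%:E <= (7 ^+ n)%:E * \sum_(0 <= i <oo) (D i ^+ n)%:E)%E.
Proof.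
move=> n0 a0 D0 ED cE.
have term0 i : (0 <= (D i ^+ n)%:E)%E by rewrite lee_fin exprn_ge0.
suff key (e : R) : 0 < e -> e <= 1 ->
    ((a ^+ n)%:E <= (7 ^+ n)%:E * (\sum_(0 <= i <oo) (D i ^+ n)%:E + e%:E))%E.
  have S0 : (0 <= \sum_(0 <= i <oo) (D i ^+ n)%:E)%E by exact: nneseries_ge0.
  have p7 : 0 < 7 ^+ n :> R by rewrite exprn_gt0.
  rewrite muleC -lee_pdivrMr//; apply/lee_addgt0Pr => e e0.
  rewrite lee_pdivrMr// muleC.
  have m0 : 0 < Num.min e 1 by rewrite lt_min e0 ltr01.
  apply: le_trans (key _ m0 _) _; first by rewrite ge_min lexx orbT.
  by rewrite lee_pmul2l//= leeD2l// lee_fin ge_min lexx.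
move=> e0 e1.
(* Widths by which the sets are enlarged to become open. Their sum is at most [e], and [th i <= 1]
   gives [th i ^+ n <= th i]. *)
pose th i : R := e / 2 ^+ i.+1.
have th0 i : 0 < th i by rewrite divr_gt0// exprn_gt0.
have th1 i : th i <= 1.
  rewrite ler_pdivrMr ?exprn_gt0// mul1r (le_trans e1)// exprn_ege1// ler1n//.
have thS i j : (i <= j)%N -> th j <= th i.
  move=> ij; rewrite ler_pM2l// lef_pV2 ?posrE ?exprn_gt0//.
  by rewrite ler_weXn2l// ler1n.
pose U i := [set u : 'rV[R]_n | exists2 v, E i v & `|u - v| < th i].
have Uo i : open (U i).
  rewrite (_ : U i = \bigcup_(v in E i) ball v (th i)).
    by apply: bigcup_open => v _; exact: ball_open.
  apply/seteqP; split=> u [v Ev uv]; exists v => //.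
    by rewrite -ball_normE /ball_/= distrC.
  by move: uv; rewrite -ball_normE /ball_/= distrC.
have UD i u v : U i u -> U i v -> `|u - v| <= D i + 2 * th i.
  move=> [u' Eu uu'] [v' Ev vv'].
  have -> : u - v = (u - u') + (u' - v') + (v' - v) by rewrite !addrA !subrK.
  apply: le_trans (ler_normD _ _) _; apply: le_trans (lerD (ler_normD _ _) (lexx _)) _.
  rewrite [`|v' - v|]distrC; have := ED _ _ _ Eu Ev; lra.
have [k ck] : exists k, forall u, cube c a u -> exists2 i, (i < k)%N & U i u.
  have := @cube_compact R n c a; rewrite compact_cover => /(_ nat setT U).
  case=> [i _|u /cE[i _ Ei]|D' _ D'c].
  - exact: Uo.
  - by exists i => //; exists u => //; rewrite subrr normr0.
  exists (\sum_(i <- finmap.enum_fset D') i).+1 => u /D'c[i /= iD' Ui]; exists i => //.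
  by rewrite ltnS (big_rem i)//= leq_addr.
(* The mesh is finer than the smallest enlargement in the finite covering. *)
have [N aN] : exists N : nat, a / th k < N.+1%:R.
  by exists (Num.truncn (a / th k)); exact: truncnS_gt.
pose K i := [set f : {ffun 'I_n -> 'I_N.+1} |
    `[< U i (\row_j (c 0 j + a * (f j)%:R / N.+1%:R)) >]]%SET.
have NR0 : 0 < N.+1%:R :> R by rewrite ltr0n.
have count : (N.+1 ^ n <= \sum_(0 <= i < k) #|K i|)%N.
  have -> : (N.+1 ^ n)%N = #|[set: {ffun 'I_n -> 'I_N.+1}]%SET|.
    by rewrite cardsT card_ffun !card_ord.
  apply: (@leq_trans #|\bigcup_(i < k) K i|%SET).
    apply: subset_leq_card; apply/fintype.subsetP => f _; apply/finset.bigcupP.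
    have [|i ik Ui] := ck (\row_j (c 0 j + a * (f j)%:R / N.+1%:R)).
      move=> j; rewrite mxE lerDl lerD2l divr_ge0 ?mulr_ge0 ?(ltW a0)//=.
      rewrite -mulrA ger_pMr// ler_pdivrMr// mul1r ler_nat.
      by rewrite ltnW.
    by exists (Ordinal ik) => //; rewrite inE; apply/asboolP.
  rewrite big_mkord; elim/big_rec2: _ => [|i s A _ IH]; first by rewrite cards0.
  by apply: leq_trans (leq_card_setU _ _) _; rewrite leq_add2l.
have bound i : (i < k)%N ->
    (#|K i|%:R : R) <= (N.+1%:R / a) ^+ n * (7 ^+ n * (D i ^+ n + th i)).
  move=> ik; have Dt0 : 0 <= D i + 2 * th i by have := D0 i; have := th0 i; lra.
  apply: le_trans (grid_count c a0 Dt0 (ltn0Sn N) (@UD i)) _.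
  have aNi : 1 <= th i * N.+1%:R / a.
    rewrite ler_pdivlMr// mul1r -ler_pdivrMl// mulrC.
    apply: le_trans (ltW aN); rewrite ler_pM2l// lef_pV2 ?posrE//.
    by apply: thS; exact: ltnW.
  (* The enlarged diameter, doubled, is [2 * D i + 4 * th i]; the added 1 is absorbed by one more
     [th i], in units of the mesh. Hence the factor 7. *)
  set M := Num.max (D i) (th i).
  have M0 : 0 <= M by rewrite le_max D0.
  apply: (@le_trans _ _ ((N.+1%:R / a * (7 * M)) ^+ n)).
    rewrite lerXn2r ?nnegrE//.
    - by rewrite addr_ge0// !mulr_ge0// ?invr_ge0 ?(ltW a0)// .
    - by rewrite !mulr_ge0// ?invr_ge0 ?(ltW a0)//.
    have -> : 2 * ((D i + 2 * th i) * N.+1%:R / a) + 1 =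
      N.+1%:R / a * (2 * D i + 4 * th i) + 1 by field; rewrite lt0r_neq0.
    have : N.+1%:R / a * (2 * D i + 5 * th i) <= N.+1%:R / a * (7 * M).
      rewrite ler_pM2l ?divr_gt0//.
      have : D i <= M by rewrite le_max lexx.
      have : th i <= M by rewrite le_max lexx orbT.
      lra.
    move: aNi; have -> : th i * N.+1%:R / a = N.+1%:R / a * th i by ring.
    lra.
  rewrite !exprMn ler_pM2l ?mulr_gt0 ?exprn_gt0 ?invr_gt0// ler_pM2l ?exprn_gt0//.
  rewrite /M; case: (leP (D i) (th i)) => _; last by rewrite lerDl ltW.
  apply: (@le_trans _ _ (th i)); last by rewrite lerDr exprn_ge0.
  by apply: ler_iXnr => //; exact: ltW.
have Nan : 0 < (N.+1%:R / a) ^+ n by rewrite exprn_gt0// divr_gt0.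
have fin : a ^+ n <= 7 ^+ n * (\sum_(0 <= i < k) D i ^+ n + e).
  apply: (@le_trans _ _ (7 ^+ n * (\sum_(0 <= i < k) (D i ^+ n + th i)))); last first.
    rewrite ler_pM2l ?exprn_gt0// big_split/= lerD2l.
    exact: sum_geometric_half (ltW e0).
  rewrite -(ler_pM2l Nan) -exprMn divfK ?lt0r_neq0//.
  rewrite -[N.+1%:R ^+ n]natrX; apply: (@le_trans _ _ (\sum_(0 <= i < k) #|K i|%:R)).
    by rewrite -natr_sum ler_nat.
  rewrite mulr_sumr mulr_sumr !big_nat; apply: ler_sum => i /andP[_ ik].
  exact: bound.
apply: (@le_trans _ _ (7 ^+ n * (\sum_(0 <= i < k) D i ^+ n + e))%:E).
  by rewrite lee_fin.
rewrite EFinM lee_pmul2l ?exprn_gt0// EFinD leeD2r// -sumEFin.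
exact: nneseries_lim_ge.
Qed.

(** A covering of [A] by sets of diameter at most [h / 2] is mapped by [P] to a covering of the cube
    by sets that are no larger. It is enough that [P] is 1-Lipschitz at short distances, since fine
    coverings already bound the measure from below. *)
Lemma hausdorff_ge_cube (R : realType) (n : nat) (T : Type) (d : T -> T -> R)
    (P : T -> 'rV[R]_n) (A : set T) (h a : R) (c : 'rV[R]_n) :
  (0 < n)%N -> 0 < h -> 0 < a ->
  (forall x y, A x -> A y -> d x y < h -> `|P x - P y| <= d x y) ->
  cube c a `<=` P @` A ->
  ((unit_ball_volume R n / 2 ^+ n * (a / 7) ^+ n)%:E <= hausdorff_measure d n A)%E.
Proof.
move=> n0 h0 a0 Ph cA.
have h20 : 0 < h / 2 by rewrite divr_gt0.
apply: le_trans (hausdorff_premeasure_le _ _ _ h20).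
apply: le_ereal_inf_tmp => _ [F [AF Fh] <-].
have Ffin i : diam d (F i) \is a fin_num.
  by rewrite ge0_fin_numE ?diam_ge0// (le_lt_trans (Fh i))// ltry.
pose D i := fine (diam d (F i)).
have D0 i : 0 <= D i by rewrite fine_ge0// diam_ge0.
have DE i : diam d (F i) = (D i)%:E by rewrite fineK.
have FD i x y : F i x -> F i y -> d x y <= D i.
  by move: x y; apply/(diam_leP _ _ (D0 i)); rewrite DE.
have Dh i : D i <= h / 2 by rewrite -lee_fin -DE.
have PD i u v : (P @` (F i `&` A)) u -> (P @` (F i `&` A)) v -> `|u - v| <= D i.
  move=> [x [Fx Ax] <-] [y [Fy Ay] <-].
  apply: le_trans (Ph _ _ Ax Ay _) (FD _ _ _ Fx Fy).
  by apply: le_lt_trans (FD _ _ _ Fx Fy) _; apply: le_lt_trans (Dh i) _; lra.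
have cPF : cube c a `<=` \bigcup_i (P @` (F i `&` A)).
  by move=> u /cA[x Ax <-]; have [i _ Fi] := AF x Ax; exists i => //; exists x.
have h1 := cube_cover n0 a0 D0 PD cPF.
have c0 : 0 < unit_ball_volume R n / 2 ^+ n by exact: cn_gt0.
rewrite (eq_eseriesr
  (g := fun i => (unit_ball_volume R n / 2 ^+ n)%:E * (D i ^+ n)%:E)%E); last first.
  by move=> i _; rewrite DE EFin_expe.
rewrite nneseriesZl; last by move=> i _; rewrite lee_fin exprn_ge0.
rewrite EFinM lee_pmul2l//= expr_div_n mulrC EFinM.
by rewrite -lee_pdivlMl ?invr_gt0 ?exprn_gt0// invrK.
Qed.

(** * The bottle metric *)

Section Bottle.
Context {R : realType} {n : nat}.
Variables (sg L : R).
Hypotheses (sg0 : 0 < sg) (sgL : sg <= L).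
Local Notation V := 'rV[R]_n.+1.
Local Ltac blra := move: (sgL) (sg0); lra.
Implicit Types (u v w : V) (s t : R).

(* [u |-> (Th u, `|u|)] embeds the space in one more dimension, as a cubical
   surface of revolution whose section at height [s] has radius [psi s]: a cap
   for [s <= sg], a cylinder for [sg <= s <= L], a flat end for [s >= L]. *)
Definition bottle_radius s : R := Num.min s sg + Num.max 0 (s - L).
Local Notation psi := bottle_radius.

Definition bottle_section u : V := (psi `|u| / `|u|) *: u.
Local Notation Th := bottle_section.

Definition bottle_dist u v : R := Num.max `| `|u| - `|v| | `|Th u - Th v|.
Local Notation m := bottle_dist.

(* An isometry on each of the two faces [Th v 0 i = +- psi `|v|]. *)
Definition bottle_chart (i : 'I_n.+1) v : V :=
  \row_j (if j == i then `|v| else Th v 0 j).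

Lemma bottle_radius_le s : s <= sg -> psi s = s.
Proof. by move=> h; rewrite /psi min_l// max_l ?addr0//; blra. Qed.

Lemma bottle_radius_mid s : sg <= s -> s <= L -> psi s = sg.
Proof. by move=> h1 h2; rewrite /psi min_r// max_l ?addr0//; blra. Qed.

Lemma bottle_radius_ge s : L <= s -> psi s = sg + (s - L).
Proof. by move=> h; rewrite /psi min_r ?max_r//; blra. Qed.

Lemma bottle_radius_cases s :
  [\/ s <= sg /\ psi s = s, [/\ sg <= s, s <= L & psi s = sg] |
      L <= s /\ psi s = sg + (s - L)].
Proof.
have [h|h] := leP s sg; first by constructor 1; rewrite bottle_radius_le.
have [h'|h'] := leP s L; first by constructor 2; rewrite bottle_radius_mid// (ltW h).
by constructor 3; rewrite bottle_radius_ge// ltW.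
Qed.

Lemma bottle_radius_mono s t : s <= t -> psi s <= psi t.
Proof.
move=> st; case: (bottle_radius_cases s) => [[? ->]|[? ? ->]|[? ->]];
  case: (bottle_radius_cases t) => [[? ->]|[? ? ->]|[? ->]]; blra.
Qed.

Lemma bottle_radius_lip s t : `|psi s - psi t| <= `|s - t|.
Proof.
wlog st : s t / s <= t.
  move=> wl; have [|/ltW] := leP s t; first exact: wl.
  by move=> ts; rewrite distrC [`|s - t|]distrC; exact: wl.
rewrite distrC [`|s - t|]distrC !ger0_norm ?subr_ge0//; last exact: bottle_radius_mono.
case: (bottle_radius_cases s) => [[? ->]|[? ? ->]|[? ->]];
  case: (bottle_radius_cases t) => [[? ->]|[? ? ->]|[? ->]]; blra.
Qed.

Lemma bottle_radius_le_id s : psi s <= s.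
Proof. case: (bottle_radius_cases s) => [[? ->]|[? ? ->]|[? ->]]; blra. Qed.

Lemma bottle_radius_ge0 s : 0 <= s -> 0 <= psi s.
Proof. by move=> s0; rewrite -(@bottle_radius_le 0) ?bottle_radius_mono ?(ltW sg0). Qed.

Lemma bottle_radius_gt0 s : 0 < s -> 0 < psi s.
Proof. move=> s0; case: (bottle_radius_cases s) => [[? ->]|[? ? ->]|[? ->]]; blra. Qed.

Lemma bottle_radius_lower s : 0 <= s -> sg / L * s <= psi s.
Proof.
have L0 : 0 < L by blra.
have sL1 : sg / L <= 1 by rewrite ler_pdivrMr// mul1r.
move=> s0; case: (bottle_radius_cases s) => [[h ->]|[h1 h2 ->]|[h ->]].
- by rewrite -[leRHS]mul1r ler_wpM2r.
- by rewrite -[leRHS]mulr1 -mulrA ler_pM2l// mulrC ler_pdivrMr// mul1r.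
have -> : sg / L * s = sg + sg / L * (s - L) by field; rewrite lt0r_neq0.
by rewrite lerD2l -[leRHS]mul1r ler_wpM2r// subr_ge0.
Qed.

Lemma bottle_section0 : Th 0 = 0.
Proof. by rewrite /Th scaler0. Qed.

Lemma bottle_section_norm u : `|Th u| = psi `|u|.
Proof.
have [->|u0] := eqVneq u 0.
  by rewrite bottle_section0 normr0 bottle_radius_le// ltW.
have nu : 0 < `|u| by rewrite normr_gt0.
by rewrite /Th normrZ ger0_norm ?divfK ?lt0r_neq0// divr_ge0 ?bottle_radius_ge0.
Qed.

Lemma bottle_dist_xx u : m u u = 0.
Proof. by rewrite /m !subrr !normr0 maxxx. Qed.

Lemma bottle_dist_sym u v : m u v = m v u.
Proof. by rewrite /m distrC [`|Th u - _|]distrC. Qed.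

Lemma bottle_dist_norm u v : `| `|u| - `|v| | <= m u v.
Proof. by rewrite /m le_max lexx. Qed.

Lemma bottle_dist_section u v : `|Th u - Th v| <= m u v.
Proof. by rewrite /m le_max lexx orbT. Qed.

Lemma bottle_dist_leP u v t : m u v <= t <-> `| `|u| - `|v| | <= t /\ `|Th u - Th v| <= t.
Proof. by rewrite /m ge_max; split=> [/andP//|[-> ->]]. Qed.

Lemma bottle_dist_ge0 u v : 0 <= m u v.
Proof. exact: le_trans (bottle_dist_norm u v). Qed.

Lemma bottle_dist_triangle u v w : m u w <= m u v + m v w.
Proof.
apply/bottle_dist_leP; split.
  apply: le_trans (lerD (bottle_dist_norm u v) (bottle_dist_norm v w)).
  exact: ler_distD.
apply: le_trans (lerD (bottle_dist_section u v) (bottle_dist_section v w)).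
exact: ler_distD.
Qed.

(** Controls the second term of [bottle_section_sub], using that [psi] is 1-Lipschitz and at most
    the identity. *)
Lemma bottle_scale_dist u v : u != 0 ->
  `|psi `|u| / `|u| - psi `|v| / `|v| | * `|v| <= 2 * `| `|u| - `|v| |.
Proof.
move=> u0; have nu : 0 < `|u| by rewrite normr_gt0.
have [->|v0] := eqVneq v 0; first by rewrite normr0 mulr0 mulr_ge0.
have nv : 0 < `|v| by rewrite normr_gt0.
rewrite -{3}[`|v|]gtr0_norm// -normrM mulrBl divfK ?lt0r_neq0//.
have -> : psi `|u| / `|u| * `|v| - psi `|v| =
   psi `|u| / `|u| * (`|v| - `|u|) + (psi `|u| - psi `|v|).
  by field; rewrite lt0r_neq0.
apply: le_trans (ler_normD _ _) _.
rewrite normrM ger0_norm ?divr_ge0 ?bottle_radius_ge0// [`| `|v| - _|]distrC.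
have h : psi `|u| / `|u| <= 1 by rewrite ler_pdivrMr// mul1r bottle_radius_le_id.
have := bottle_radius_lip `|u| `|v|.
have : psi `|u| / `|u| * `| `|u| - `|v| | <= 1 * `| `|u| - `|v| | by rewrite ler_wpM2r.
blra.
Qed.

Lemma bottle_section_sub u v :
  Th u - Th v = (psi `|u| / `|u|) *: (u - v) + (psi `|u| / `|u| - psi `|v| / `|v|) *: v.
Proof. by rewrite /Th scalerBr scalerBl addrA subrK. Qed.

Lemma bottle_dist_le_norm u v : m u v <= 3 * `|u - v|.
Proof.
wlog u0 : u v / u != 0.
  move=> wl; have [u0|] := eqVneq u 0; last exact: wl.
  have [v0|v0] := eqVneq v 0; last by rewrite bottle_dist_sym distrC; exact: wl.
  by rewrite u0 v0 bottle_dist_xx mulr_ge0.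
have nu : 0 < `|u| by rewrite normr_gt0.
have d1 : `| `|u| - `|v| | <= `|u - v| by exact: ler_dist_dist.
apply/bottle_dist_leP; split; first by have := normr_ge0 (u - v); blra.
rewrite bottle_section_sub; apply: le_trans (ler_normD _ _) _.
rewrite normrZ [X in _ + X]normrZ.
have := bottle_scale_dist v u0.
have h : psi `|u| / `|u| <= 1 by rewrite ler_pdivrMr// mul1r bottle_radius_le_id.
have hq : 0 <= psi `|u| / `|u| by rewrite divr_ge0// bottle_radius_ge0.
rewrite (ger0_norm hq).
have : psi `|u| / `|u| * `|u - v| <= 1 * `|u - v| by rewrite ler_wpM2r.
blra.
Qed.

(** The ratio [psi s / s] is smallest at [s = L], the end of the cylinder, where it equals
    [sg / L]. *)
Lemma norm_le_bottle_dist u v : `|u - v| <= 3 * (L / sg) * m u v.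
Proof.
have L0 : 0 < L by blra.
wlog u0 : u v / u != 0.
  move=> wl; have [u0|] := eqVneq u 0; last exact: wl.
  have [v0|v0] := eqVneq v 0; last by rewrite bottle_dist_sym distrC; exact: wl.
  by rewrite u0 v0 subrr normr0 !mulr_ge0// ?invr_ge0 ?bottle_dist_ge0// ltW.
have nu : 0 < `|u| by rewrite normr_gt0.
have h : sg / L <= psi `|u| / `|u| by rewrite ler_pdivlMr// bottle_radius_lower.
have sL : 0 < sg / L by rewrite divr_gt0.
suff : sg / L * `|u - v| <= 3 * m u v.
  rewrite -[sg / L]invf_div mulrC ler_pdivrMr ?divr_gt0//.
  by have -> : 3 * (L / sg) * m u v = 3 * m u v * (L / sg) by ring.
apply: (@le_trans _ _ (psi `|u| / `|u| * `|u - v|)); first by rewrite ler_wpM2r.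
have -> : psi `|u| / `|u| * `|u - v| = `|(psi `|u| / `|u|) *: (u - v)|.
  by rewrite normrZ ger0_norm// (le_trans (ltW sL)).
have -> : (psi `|u| / `|u|) *: (u - v) =
   (Th u - Th v) - (psi `|u| / `|u| - psi `|v| / `|v|) *: v.
  by rewrite bottle_section_sub addrK.
apply: le_trans (ler_normB _ _) _; rewrite normrZ.
have := bottle_scale_dist v u0; have := bottle_dist_norm u v.
have := bottle_dist_section u v; blra.
Qed.

Lemma bottle_chart_lip i u v : `|bottle_chart i u - bottle_chart i v| <= m u v.
Proof.
apply/(rV_norm_leP _ (bottle_dist_ge0 u v)) => j; rewrite !mxE.
case: ifP => _; first exact: bottle_dist_norm.
apply: le_trans (bottle_dist_section u v).
by have := rV_coord_le_norm (Th u - Th v) j; rewrite !mxE.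
Qed.

(** The coordinate of the section that the chart omits is, up to sign, [psi] of the recorded height,
    hence a 1-Lipschitz function of it. *)
Lemma bottle_chart_face (b : bool) i u v :
  Th u 0 i = (-1) ^+ b * psi `|u| -> Th v 0 i = (-1) ^+ b * psi `|v| ->
  m u v <= `|bottle_chart i u - bottle_chart i v|.
Proof.
move=> ui vi.
have ci := rV_coord_le_norm (bottle_chart i u - bottle_chart i v) i.
rewrite !mxE eqxx in ci.
apply/bottle_dist_leP; split=> //; apply/(rV_norm_leP _ (normr_ge0 _)) => j.
have := rV_coord_le_norm (bottle_chart i u - bottle_chart i v) j.
rewrite !mxE; case: eqVneq => [-> _|_//].
have := ui; have := vi; rewrite !mxE => -> ->; rewrite -mulrBr normrM normr_sign mul1r.
exact: le_trans (bottle_radius_lip _ _) ci.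
Qed.

Lemma bottle_face u : exists (i : 'I_n.+1) (b : bool),
  u 0 i = (-1) ^+ b * `|u| /\ Th u 0 i = (-1) ^+ b * psi `|u|.
Proof.
have [i ui] := rV_norm_coord u; pose b : bool := u 0 i < 0; exists i, b.
have e : u 0 i = (-1) ^+ b * `|u|.
  rewrite ui /b; case: ltP => h; first by rewrite ltr0_norm// expr1 mulN1r opprK.
  by rewrite ger0_norm// mul1r.
split=> //; rewrite mxE {1}e.
have [->|u0] := eqVneq u 0; first by rewrite normr0 bottle_radius_le ?(ltW sg0)// mulr0 !mulr0.
by rewrite mulrCA divfK// normr_eq0.
Qed.

(** Each of the [2 * n.+1] faces is cut through its chart into [q ^ n.+1] cubes of side [h], where
    [q * h <= 2 * t + h <= 3 * t]. *)
Lemma bottle_ball_cover u t h : 0 < t -> 0 < h -> h <= t -> exists N (F : nat -> set V),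
  [/\ forall z, m u z <= t -> exists2 i, (i < N)%N & F i z,
      forall i x y, F i x -> F i y -> m x y <= h &
      N%:R * h ^+ n.+1 <= (2 * n.+1)%:R * (3 * t) ^+ n.+1].
Proof.
move=> t0 h0 ht.
pose q := (Num.truncn (2 * t / h)).+1.
pose I := ('I_n.+1 * bool * {ffun 'I_n.+1 -> 'I_q})%type.
pose c i j := bottle_chart i u 0 j - t.
pose F (x : I) := [set v : V | Th v 0 x.1.1 = (-1) ^+ x.1.2 * psi `|v| /\
  forall j, c x.1.1 j + (x.2 j)%:R * h <= bottle_chart x.1.1 v 0 j <= c x.1.1 j + (x.2 j)%:R * h + h].
have qh : q%:R * h <= 3 * t.
  rewrite -ler_pdivlMr// /q -[_.+1%:R in leLHS]natr1.
  have : (Num.truncn (2 * t / h))%:R <= 2 * t / h by rewrite truncn_le// divr_ge0// ?mulr_ge0// ltW.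
  have : 1 <= t / h by rewrite ler_pdivlMr// mul1r.
  have -> : 3 * t / h = 2 * t / h + t / h by field; rewrite lt0r_neq0.
  blra.
have FI x v w : F x v -> F x w -> m v w <= h.
  move=> [v1 v2] [w1 w2]; apply: le_trans (bottle_chart_face v1 w1) _.
  apply/(rV_norm_leP _ (ltW h0)) => j; have := v2 j; have := w2 j; rewrite !mxE ler_norml.
  blra.
have cov z : m u z <= t -> exists x, F x z.
  move=> mz; have [i [b [_ zi]]] := bottle_face z.
  have cz j : c i j <= bottle_chart i z 0 j <= c i j + 2 * t.
    have := le_trans (bottle_chart_lip i u z) mz => /(rV_norm_leP _ (ltW t0))/(_ j).
    rewrite mxE [X in _ + X]mxE ler_norml /c => /andP[h1 h2]; apply/andP; split; blra.
  pose k j := Num.truncn ((bottle_chart i z 0 j - c i j) / h).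
  have kq j : (k j < q)%N.
    by rewrite ltnS le_truncn// ler_pM2r ?invr_gt0//; have := cz j; blra.
  exists (i, b, [ffun j => Ordinal (kq j)]); split=> //= j; rewrite ffunE/=.
  have := @truncn_itv R ((bottle_chart i z 0 j - c i j) / h).
  rewrite divr_ge0 ?(ltW h0) ?subr_ge0//; last by case/andP: (cz j).
  move=> /(_ isT); rewrite -/(k j) ler_pdivlMr// ltr_pdivrMr// -natr1 => /andP[h1 h2].
  by blra.
exists #|{: I}|, (fun k => if insub k is Some o then F (enum_val (o : 'I_#|{: I}|)) else set0).
split.
- move=> z /cov[x Fx]; exists (enum_rank x) => //.
  by rewrite valK enum_rankK.
- by move=> i x y; case: insub => // o; exact: FI.
rewrite !card_prod card_bool card_ffun !card_ord natrM natrX -mulrA -exprMn mulnC.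
rewrite ler_wpM2l// lerXn2r ?nnegrE ?mulr_ge0 ?ler0n//; exact: ltW.
Qed.

(** The alternative in the hypothesis ensures that the section at height [|u| + t / 2] has radius at
    least [t / 2]. Around the cylinder, a bottle ball with [t] much larger than [sg] is too thin for
    this. *)
Lemma bottle_ball_cube u t : 0 < t -> t <= 2 * sg \/ L <= `|u| ->
  exists i c, cube c (t / 2) `<=` bottle_chart i @` [set v | m u v <= t].
Proof.
move=> t0 tu; have [i [b [ui Tui]]] := bottle_face u.
set s := `|u| in ui Tui tu *.
have s0 : 0 <= s by exact: normr_ge0.
pose a := psi (s + t / 2).
have at2 : t / 2 <= a.
  rewrite /a; case: (bottle_radius_cases (s + t / 2)) => [[? ->]|[? ? ->]|[? ->]]; case: tu => ?; blra.
have sa : psi s <= a by apply: bottle_radius_mono; blra.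
have Ta j : `|Th u 0 j| <= psi s.
  by rewrite -bottle_section_norm; exact: rV_coord_le_norm.
(* Heights are taken beyond that of [u], where sections are larger, and the other coordinates are
   moved from those of [Th u] towards 0, so that the cube stays within the face. *)
exists i, (\row_j (if j == i then s + t / 2 else
   if 0 <= Th u 0 j then Th u 0 j - t / 2 else Th u 0 j)).
move=> y yc.
have yi : s + t / 2 <= y 0 i <= s + t by have := yc i; rewrite !mxE eqxx; lra.
set s' := y 0 i in yi *.
have s'0 : 0 < s' by lra.
have p0 : 0 < psi s' by exact: bottle_radius_gt0.
have yj j : j != i -> `|y 0 j| <= psi s' /\ `|Th u 0 j - y 0 j| <= t.
  move=> ji; have as' : a <= psi s' by apply: bottle_radius_mono; lra.
  have := yc j; rewrite [X in X <= _]mxE [X in _ <= X + _]mxE (negbTE ji).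
  have := Ta j; rewrite !ler_norml => /andP[h1 h2].
  by case: ifPn => h /andP[h3 h4]; rewrite -?ltNge in h; split; apply/andP; split; lra.
(* The point of the face at height [s'] whose section has the remaining coordinates of [y]. *)
pose v : V := \row_j (if j == i then (-1) ^+ b * s' else y 0 j * (s' / psi s')).
have vs' : `|v| = s'.
  apply/eqP; rewrite eq_le; apply/andP; split.
    apply/(rV_norm_leP _ (ltW s'0)) => j; rewrite mxE; case: eqVneq => [_|/yj[yj1 _]].
      by rewrite normrM normr_sign mul1r gtr0_norm.
    rewrite normrM (gtr0_norm (divr_gt0 s'0 p0)) mulrA ler_pdivrMr// mulrC.
    by rewrite ler_pM2l.
  have := rV_coord_le_norm v i; rewrite mxE eqxx normrM normr_sign mul1r.
  by rewrite gtr0_norm.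
have Tvj j : j != i -> Th v 0 j = y 0 j.
  move=> ji; rewrite /Th vs' !mxE (negbTE ji).
  by field; rewrite !lt0r_neq0.
have Tvi : Th v 0 i = (-1) ^+ b * psi s'.
  by rewrite /Th vs' !mxE eqxx; field; rewrite lt0r_neq0.
have ss' : `|s - s'| <= t by rewrite ler_norml; apply/andP; split; lra.
exists v.
  apply/bottle_dist_leP; rewrite vs'; split=> //.
  apply/(rV_norm_leP _ (ltW t0)) => j; rewrite mxE [X in _ + X]mxE.
  have [->|ji] := eqVneq j i; last by rewrite Tvj//; case: (yj j ji).
  rewrite Tvi Tui -mulrBr normrM normr_sign mul1r.
  exact: le_trans (bottle_radius_lip _ _) ss'.
apply/rowP => j; rewrite mxE; case: eqVneq => [->|ji]; first exact: vs'.
exact: Tvj.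
Qed.

(** The diagonal ray. It follows a corner of the cubical sections, and [bottle_axis_dist] shows that
    it is a geodesic parametrized by height. *)
Definition bottle_axis s : V := const_mx s.
Local Notation ax := bottle_axis.

Lemma bottle_axis_norm s : 0 <= s -> `|ax s| = s.
Proof.
move=> s0; have [j ->] := rV_norm_coord (ax s).
by rewrite mxE ger0_norm.
Qed.

Lemma bottle_section_axis s : 0 <= s -> Th (ax s) = ax (psi s).
Proof.
move=> s0; rewrite /Th bottle_axis_norm//; apply/rowP => j; rewrite !mxE.
have [->|sn0] := eqVneq s 0; last by rewrite divfK.
by rewrite mulr0 bottle_radius_le// ltW.
Qed.

Lemma bottle_axis_dist s t : 0 <= s -> 0 <= t -> m (ax s) (ax t) = `|s - t|.
Proof.
move=> s0 t0; rewrite /m !bottle_axis_norm// !bottle_section_axis//.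
have -> : ax (psi s) - ax (psi t) = const_mx (psi s - psi t).
  by apply/rowP => j; rewrite !mxE.
have [j ->] := rV_norm_coord (const_mx (psi s - psi t) : V).
by rewrite mxE max_l// bottle_radius_lip.
Qed.

Lemma bottle_axis0 : ax 0 = 0.
Proof. by apply/rowP => j; rewrite !mxE. Qed.

Lemma bottle_dist_axis_le v s : 0 <= s ->
  m v (ax s) <= Num.max `| `|v| - s | (psi `|v| + psi s).
Proof.
move=> s0; apply/bottle_dist_leP; rewrite bottle_axis_norm// bottle_section_axis//.
rewrite !le_max lexx; split=> //; apply/orP; right.
apply: le_trans (ler_normB _ _) _.
by rewrite bottle_section_norm bottle_axis_norm// bottle_radius_ge0.
Qed.

Lemma bottle_dist_axis_tube v s : 0 <= s -> s <= L -> `|v| <= L -> `| `|v| - s | <= 2 * sg ->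
  m v (ax s) <= 2 * sg.
Proof.
move=> s0 sL vL vs; apply: le_trans (bottle_dist_axis_le _ s0) _.
have tube t : t <= L -> psi t <= sg.
  by case: (bottle_radius_cases t) => [[? ->]|[? ? ->]|[? ->]]; blra.
by rewrite ge_max vs/=; have := tube _ sL; have := tube _ vL; lra.
Qed.

Lemma bottle_dist_axis_end v : L <= `|v| -> m v (ax L) <= `|v| - L + 2 * sg.
Proof.
move=> vL; apply: le_trans (bottle_dist_axis_le _ _) _; first by blra.
rewrite (bottle_radius_ge vL) (bottle_radius_mid sgL (lexx _)) ge_max.
by rewrite ger0_norm ?subr_ge0//; apply/andP; split; blra.
Qed.

End Bottle.

(** * Gluing in shortcuts *)

Section Gluing.
Context {R : realType} {T X : Type} {I : finType}.
Variables (m : T -> T -> R) (d : X -> X -> R) (a : I -> T) (w : I -> X) (kp : R).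
Hypotheses (m_met : is_metric m) (d_met : is_metric d) (kp0 : 0 < kp).
Hypothesis dm : forall i j, d (w i) (w j) <= m (a i) (a j).

(* The metric on [T] in which moving from [a i] to [a j] costs at most
   [kp + d (w i) (w j)]. *)
Definition glue (u v : T) : R :=
  \big[Num.min/m u v]_(p : I * I) (kp + (m u (a p.1) + d (w p.1) (w p.2) + m (a p.2) v)).

Lemma glueP u v : glue u v = m u v \/
  exists i j, glue u v = kp + (m u (a i) + d (w i) (w j) + m (a j) v).
Proof.
have := lexx (glue u v) => /bigmin_leP[h|[[i j] _ /= h]].
  by left; apply/eqP; rewrite eq_le h bigmin_le_id.
right; exists i, j; apply/eqP; rewrite eq_le h andbT.
exact: (bigmin_le _ (i, j)).
Qed.

Lemma glue_le u v : glue u v <= m u v.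
Proof. exact: bigmin_le_id. Qed.

Lemma glue_shortcut u v i j : glue u v <= kp + (m u (a i) + d (w i) (w j) + m (a j) v).
Proof. exact: (bigmin_le _ (i, j)). Qed.

(** One shortcut is enough: [i] to [j] followed by [k] to [l] is replaced by [i] to [l], because
    [dm] bounds [d (w j) (w k)] by the length of the path travelled between the two. *)
Lemma glue_metric : is_metric glue.
Proof.
have [m0 mE mC mD] := m_met; have [d0 dE dC dD] := d_met.
have k0 := kp0.
have g0 u v : 0 <= glue u v.
  have [->|[i [j ->]]] := glueP u v; first exact: m0.
  by have := m0 u (a i); have := m0 (a j) v; have := d0 (w i) (w j); lra.
have gCle u v : glue u v <= glue v u.
  have [->|[i [j ->]]] := glueP v u; first by rewrite mC glue_le.
  apply: le_trans (glue_shortcut _ _ j i) _.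
  by rewrite [m u _]mC [m _ v]mC [d _ _]dC; lra.
split=> //.
- move=> u v; split; last by move=> ->; apply/eqP; rewrite eq_le g0 andbT -(proj2 (mE v v) erefl) glue_le.
  have [->|[i [j ->]]] := glueP u v; first by move/mE.
  by move=> e; exfalso; move: e; have := m0 u (a i); have := m0 (a j) v; have := d0 (w i) (w j); lra.
- by move=> u v; apply/eqP; rewrite eq_le !gCle.
move=> u v z; have [->|[i [j ->]]] := glueP u v; have [->|[k [l ->]]] := glueP v z.
- exact: le_trans (glue_le _ _) (mD u v z).
- apply: le_trans (glue_shortcut _ _ k l) _.
  by have := mD u v (a k); lra.
- apply: le_trans (glue_shortcut _ _ i j) _.
  by have := mD (a j) v z; lra.
apply: le_trans (glue_shortcut _ _ i l) _.
have := dD (w i) (w j) (w l); have := dD (w j) (w k) (w l); have := dm j k.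
by have := mD (a j) v (a k); lra.
Qed.

Lemma glue_local u v : glue u v < kp -> glue u v = m u v.
Proof.
have [m0 _ _ _] := m_met; have [d0 _ _ _] := d_met.
have [->//|[i [j ->]]] := glueP u v.
by have := m0 u (a i); have := m0 (a j) v; have := d0 (w i) (w j); lra.
Qed.

Lemma glue_mark_le i j : glue (a i) (a j) <= kp + d (w i) (w j).
Proof.
apply: le_trans (glue_shortcut _ _ i j) _; have [_ mE _ _] := m_met.
by rewrite !(proj2 (mE _ _) erefl) add0r addr0.
Qed.

(** A path that starts at a mark can be compared with one that starts in [X]: by [dm] its first leg
    is no shorter than the corresponding distance in [X]. *)
Lemma glue_from_mark i u : exists j, d (w i) (w j) + m (a j) u <= glue (a i) u.
Proof.
have [m0 _ _ _] := m_met; have [d0 dE _ dD] := d_met.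
have [->|[j [k ->]]] := glueP (a i) u.
  by exists i; rewrite (proj2 (dE _ _) erefl) add0r.
exists k; have := dD (w i) (w j) (w k); have := dm i j; have := kp0; lra.
Qed.

Lemma glue_mark_ge i j : d (w i) (w j) <= glue (a i) (a j).
Proof.
have [k] := glue_from_mark i (a j); apply: le_trans.
have [_ _ _ dD] := d_met; have := dD (w i) (w k) (w j); have := dm k j; lra.
Qed.

(** When [m u v <= 2 * M], the cost [kp] of a shortcut suffices. Beyond that, a shortcut saves at
    most [M], less than half of [m u v]. *)
Lemma glue_lower (M : R) : kp <= M -> (forall i j, m (a i) (a j) <= M) ->
  forall u v, kp / (2 * M) * m u v <= glue u v.
Proof.
move=> kM aM u v; have [m0 _ _ mD] := m_met; have [d0 _ _ _] := d_met; have k0 := kp0.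
have M0 : 0 < 2 * M by lra.
have c1 : kp / (2 * M) <= 1 by rewrite ler_pdivrMr//; lra.
have cm : kp / (2 * M) * m u v <= m u v by rewrite -[leRHS]mul1r ler_wpM2r.
have [->//|[i [j ->]]] := glueP u v.
have h : m u v - M <= m u (a i) + d (w i) (w j) + m (a j) v.
  have := mD u (a i) v; have := mD (a i) (a j) v; have := aM i j; have := d0 (w i) (w j); lra.
have [mM|mM] := leP (m u v) (2 * M).
  apply: (@le_trans _ _ kp).
    by rewrite mulrAC ler_pdivrMr// ler_pM2l.
  have := m0 u (a i); have := m0 (a j) v; have := d0 (w i) (w j); lra.
have : kp / (2 * M) * m u v <= 2^-1 * m u v.
  rewrite ler_wpM2r// ler_pdivrMr//; lra.
lra.
Qed.

End Gluing.

(** * Norms on row vectors *)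

Section FiniteNets.
Context {R : realType} {n : nat}.
Local Notation V := 'rV[R]_n.+1.
Variable N : V -> R.
Hypothesis N_norm : is_norm N.

Lemma is_norm0 : N 0 = 0.
Proof. by have [_ NE _ _] := N_norm; apply/NE. Qed.

Lemma is_normN u : N (- u) = N u.
Proof. by have [_ _ NZ _] := N_norm; rewrite -scaleN1r NZ normrN1 mul1r. Qed.

Lemma is_normB u v : N (u - v) = N (v - u).
Proof. by rewrite -is_normN opprB. Qed.

Lemma is_norm_triangle u v w : N (u - w) <= N (u - v) + N (v - w).
Proof.
have [_ _ _ ND] := N_norm.
by have := ND (u - v) (v - w); rewrite addrA subrK.
Qed.

Lemma is_norm_upper : exists2 C : R, 0 < C & forall u, N u <= C * `|u|.
Proof.
have [N0 NE NZ ND] := N_norm.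
exists (1 + \sum_j N (delta_mx 0 j)).
  by rewrite ltr_pwDl// sumr_ge0.
move=> u; rewrite {1}(row_sum_delta u).
have Nsum (s : seq 'I_n.+1) (f : 'I_n.+1 -> V) : N (\sum_(j <- s) f j) <= \sum_(j <- s) N (f j).
  elim: s => [|j s IH]; first by rewrite !big_nil is_norm0.
  by rewrite !big_cons; apply: le_trans (ND _ _) _; rewrite lerD2l.
apply: le_trans (Nsum _ _) _.
rewrite mulrDl mul1r mulr_suml; apply: ler_wpDl => //; apply: ler_sum => j _.
by rewrite NZ mulrC ler_wpM2l// rV_coord_le_norm.
Qed.

Lemma is_norm_lower : exists2 c : R, 0 < c & forall u, c * `|u| <= N u.
Proof.
have [N0 NE NZ ND] := N_norm; have [C C0 NC] := is_norm_upper.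
have Ncont : continuous N.
  move=> u; have FF := nbhs_filter u; apply/cvgrPdist_le => e e0.
  have nb : nbhs u (ball u (e / C)) by apply: nbhsx_ballx; rewrite divr_gt0.
  apply: filterS nb => v; rewrite -ball_normE /ball_/= => uv.
  have d1 : `|N u - N v| <= N (u - v).
    rewrite ler_norml lerBrDr addrC lerBlDr is_normB; apply/andP; split.
      by have := ND (v - u) u; rewrite subrK; lra.
    by rewrite is_normB; have := ND (u - v) v; rewrite subrK; lra.
  apply: le_trans d1 _; apply: le_trans (NC _) _; rewrite mulrC -ler_pdivlMr//.
  exact: ltW.
pose S : set V := [set u | `|u| = 1].
have S1 : S (const_mx 1).
  rewrite /S/=; have [j ->] := rV_norm_coord (const_mx 1 : V).
  by rewrite mxE normr1.
have cS : compact S.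
  apply: bounded_closed_compact.
    by exists 1; split=> // M M1 u /= ->; exact: ltW.
  apply: (@closed_comp _ _ (fun u : V => `|u|) [set 1]) => [u _|].
    exact: norm_continuous.
  exact: closed_eq.
have [|c0 /set_mem c0S cmin] := EVT_min_rV (f := N) _ cS (continuous_subspaceT Ncont).
  by exists (const_mx 1).
have c00 : 0 < N c0.
  rewrite lt_neqAle N0 andbT eq_sym; apply/eqP => /NE c0E.
  by move: c0S; rewrite /S/= c0E normr0 => /eqP; rewrite eq_sym oner_eq0.
exists (N c0) => // u; have [->|u0] := eqVneq u 0; first by rewrite normr0 mulr0.
have nu : 0 < `|u| by rewrite normr_gt0.
have := cmin (`|u|^-1 *: u); rewrite NZ normfV normr_id => h.
rewrite -ler_pdivlMr// mulrC h// inE /S /=.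
by rewrite normrZ normfV normr_id mulVf ?lt0r_neq0.
Qed.

Lemma is_norm_net (D h : R) : 0 < h ->
  exists s : seq V, forall u, N u <= D -> exists2 v, v \in s & N (u - v) <= h.
Proof.
move=> h0; have [C C0 NC] := is_norm_upper; have [c c0 Nc] := is_norm_lower.
pose B : set V := [set u | `|u| <= D / c].
have cB : compact B.
  apply: bounded_closed_compact.
    exists (D / c); split; first exact: num_real.
    by move=> M M1 u /= uM; exact: le_trans uM (ltW M1).
  apply: (@closed_comp _ _ (fun u : V => `|u|) [set x | x <= D / c]) => [u _|].
    exact: norm_continuous.
  exact: closed_le.
move: cB; rewrite compact_cover => /(_ V setT (fun v => ball v (h / C))).
case=> [v _|u _|s _ sc]; first exact: ball_open.
  by exists u => //; apply: ballxx; rewrite divr_gt0.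
exists (finmap.enum_fset s) => u uD; have [|v /= vs] := sc u.
  by rewrite /B/= ler_pdivlMr// mulrC (le_trans (Nc u)).
rewrite -ball_normE /ball_/= => uv; exists v => //.
apply: le_trans (NC _) _; rewrite mulrC -ler_pdivlMr// distrC.
exact: ltW.
Qed.

End FiniteNets.

(** * Walks through finite graphs *)

Section Walks.
Context {T : eqType}.
Variable e : rel T.
Hypotheses (e_sym : symmetric e) (e_refl : reflexive e).

(* Depth-first traversal of a spanning tree. *)
Lemma tree_walk (F : seq T) (x0 : T) : uniq F -> x0 \in F ->
  (forall V : seq T, {subset V <= F} -> x0 \in V -> ~~ all (mem V) F ->
     exists p q, [/\ p \in V, q \in F, q \notin V & e p q]) ->
  exists W, [/\ path e x0 W, last x0 W = x0, x0 :: W =i F &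
    forall p, (count_mem p (x0 :: W) <= 1 + count (e p) F)%N].
Proof.
move=> uF x0F conn.
(* The visited set [V] grows by one point at a time until it exhausts [F]. *)
have step k : exists V W, [/\ uniq V, {subset V <= F}, (k < size V)%N \/ all (mem V) F &
  [/\ path e x0 W, last x0 W = x0, x0 :: W =i V &
    forall p, (count_mem p (x0 :: W) <= 1 + count (e p) V)%N]].
  elim: k => [|k [V [W [uV VF sV [pW lW WV cW]]]]].
    exists [:: x0], [::]; split=> //.
    - by move=> z; rewrite inE => /eqP ->.
    - by left.
    - by split=> // p; rewrite /=; case: (x0 == p).
  have [all_V|nall] := boolP (all (mem V) F).
    by exists V, W; split=> //; right.
  have x0V : x0 \in V by rewrite -WV mem_head.
  have [p [q [pV qF qV epq]]] := conn V VF x0V nall.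
  have qp : q != p by apply: contraNneq qV => ->.
  (* The detour from [p] to [q] and back is inserted at an occurrence of [p]. *)
  have [W' [pW' lW' cW']] : exists W', [/\ path e x0 W', last x0 W' = x0 &
      perm_eq (x0 :: W') (p :: q :: x0 :: W)].
    have [px0|px0] := eqVneq p x0.
      move: epq; rewrite px0 => exq; exists (q :: x0 :: W).
      by rewrite /= exq [e q x0]e_sym exq.
    have : p \in W by move: pV; rewrite -WV in_cons (negbTE px0).
    case/splitPr def_W: W / => [W1 W2]; rewrite def_W in pW lW *.
    exists (W1 ++ p :: q :: p :: W2); move: pW lW; rewrite !cat_path !last_cat /=.
    move=> /and3P[-> -> ->] ->; rewrite epq [e q p]e_sym epq; split=> //.
    by apply/permP => P; rewrite /= !count_cat /=; ring.
  exists (q :: V), W'; split.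
  - by rewrite /= qV.
  - by move=> z; rewrite in_cons => /predU1P[->//|/VF].
  - by left; case: sV => // aV; rewrite aV in nall.
  split=> //.
    move=> z; rewrite (perm_mem cW') !in_cons -WV in_cons.
    by have [->|] := eqVneq z p; rewrite // orbCA orbA; move: pV; rewrite -WV in_cons => ->; rewrite !orbT.
  move=> z; rewrite (permP cW') /=.
  have cz := cW z; rewrite /= in cz.
  (* [p] gains one visit together with the new neighbour [q], while [q] is visited for the first
     time. *)
  have e_arith a b (b1 b2 b3 : bool) : (a <= 1 + b)%N -> (b1 + b2 <= 1)%N ->
      (b1 -> b3) -> (b2 -> a = 0)%N -> (b1 + (b2 + a) <= 1 + (b3 + b))%N.
    by clear; case: b1; case: b2; case: b3 => //=; lia.
  apply: e_arith cz _ _ _.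
  - by case: (eqVneq p z) => [<-|_]; [rewrite (negbTE qp)|case: (q == z)].
  - by move=> /eqP <-.
  move=> /eqP qz; have : z \notin x0 :: W by rewrite WV -qz.
  by rewrite -has_pred1 has_count /= -leqNgt leqn0 => /eqP.
have [V [W [uV VF sV [pW lW WV cW]]]] := step (size F).
have FV : {subset F <= V}.
  case: sV => [sFV|/allP//]; exfalso; move: sFV.
  by rewrite ltnNge uniq_leq_size.
have VE : V =i F by move=> z; apply/idP/idP => [/VF|/FV].
exists W; split=> // [z|p]; first by rewrite WV.
by have := cW p; rewrite (permP (uniq_perm uV uF VE)).
Qed.

Lemma covering_walk (F : seq T) (x0 x1 : T) : uniq F -> x0 \in F -> x1 \in F ->
  (forall V : seq T, {subset V <= F} -> x1 \in V -> ~~ all (mem V) F ->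
     exists p q, [/\ p \in V, q \in F, q \notin V & e p q]) ->
  exists W, [/\ path e x0 W, last x0 W = x1, x0 :: W =i F &
    forall p, (count_mem p (x0 :: W) <= 2 * (1 + count (e p) F))%N].
Proof.
move=> uF x0F x1F conn; have [W [pW lW WF cW]] := tree_walk uF x1F conn.
have [->|x01] := eqVneq x0 x1.
  by exists W; split=> // p; apply: leq_trans (cW p) _; rewrite leq_pmull.
have : x0 \in W by move: x0F; rewrite -WF in_cons (negbTE x01).
case/splitPr def_W: W / => [W1 W2].
have [pW2 lW2] : path e x0 W2 /\ last x0 W2 = x1.
  by move: pW lW; rewrite def_W cat_path last_cat /= => /and3P[].
(* The tail of the closed walk leads from [x0] to [x1]; the whole closed walk follows, which doubles
   the counts. Reflexivity of [e] allows the repetition of [x1]. *)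
exists (W2 ++ x1 :: W); split.
- by rewrite cat_path pW2 lW2 /= e_refl.
- by rewrite last_cat.
- move=> z; rewrite in_cons mem_cat WF.
  case: (eqVneq z x0) => [->|_] /=; first by rewrite x0F.
  apply/idP/idP => [/orP[zW2|//]|->]; last by rewrite orbT.
  by rewrite -WF def_W in_cons mem_cat in_cons zW2 !orbT.
move=> p; have := cW p; rewrite def_W /= !count_cat /= count_cat /=.
move: (count_mem p W1) (count_mem p W2) (count (e p) F) (nat_of_bool (x0 == p)) (nat_of_bool (x1 == p)).
by clear; lia.
Qed.

End Walks.

(** * Consequences of flatness *)

Section Flatness.
Context {R : realType} {n : nat} {T : Type}.
Variables (d : T -> T -> R) (delta s0 : R).
Hypotheses (d_met : is_metric d) (flat : reifenberg_flat n.+1 d delta s0).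
Hypotheses (delta0 : 0 < delta) (s00 : 0 < s0).
Local Notation V := 'rV[R]_n.+1.

(** The infimum in [xi] need not be attained, hence [2 * delta]; as zeta and eta are nonnegative,
    each is below this bound. *)
Lemma reifenberg_chart x D : s0 < D -> exists (N : V -> R) (phi : T -> V),
  [/\ is_norm N, forall y, d x y <= D -> N (phi y) <= D,
      forall y z, d x y <= D -> d x z <= D ->
        `|d y z - N (phi y - phi z)| <= 2 * delta * D &
      forall u, N u <= D -> exists2 y, d x y <= D & N (u - phi y) <= 2 * delta * D].
Proof.
move=> sD; have D0 : 0 < D by exact: lt_trans s00 sD.
have [d0 dE dC dD] := d_met; have de0 := delta0.
have : (xi n.+1 d x D < (2 * delta)%:E)%E.
  by apply: le_lt_trans (flat x sD) _; rewrite lte_fin; lra.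
move=> /ereal_inf_lt[_ [N /= N_norm <-]] /ereal_inf_lt[_ [phi /= phiB <-]] ze.
have [N0 NE NZ ND] := N_norm.
have dxx : d x x <= D by rewrite (proj2 (dE x x) erefl) ltW.
have z0 : (0 <= zeta d x D N phi)%E.
  rewrite mule_ge0 ?lee_fin ?invr_ge0 ?(ltW D0)//.
  apply: le_trans (ereal_sup_ubound _); last by exists (x, x) => /=.
  by rewrite lee_fin.
have sd0 u : (0 <= set_dist (norm_dist N) u (phi @` cball d x D))%E.
  by apply: le_ereal_inf_tmp => _ [v _ <-]; rewrite lee_fin; exact: N0.
have e0 : (0 <= Defs.eta d x D N phi)%E.
  rewrite mule_ge0 ?lee_fin ?invr_ge0 ?(ltW D0)//.
  apply: le_trans (sd0 0) (ereal_sup_ubound _); exists 0 => //.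
  by rewrite /cball /= /norm_dist subrr is_norm0// ltW.
have zlt : (zeta d x D N phi < (2 * delta)%:E)%E by apply: le_lt_trans ze; exact: leeDl.
have elt : (Defs.eta d x D N phi < (2 * delta)%:E)%E by apply: le_lt_trans ze; exact: leeDr.
have dD2 : 2 * delta * D = D * (2 * delta) by rewrite mulrC.
exists N, phi; split=> //.
- move=> y /phiB; rewrite /cball /= /norm_dist sub0r is_normN//.
- move=> y z xy xz; rewrite -lee_fin dD2.
  move: zlt; rewrite /zeta lte_pdivrMl// => /ltW; apply: le_trans.
  by apply: ereal_sup_ubound; exists (y, z).
move=> u uD; move: elt; rewrite /Defs.eta lte_pdivrMl//.
have uB : [set set_dist (norm_dist N) u (phi @` cball d x D) | u in cball (norm_dist N) 0 D]
    (set_dist (norm_dist N) u (phi @` cball d x D)).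
  by exists u => //; rewrite /cball/= /norm_dist sub0r is_normN.
move=> /(le_lt_trans (ereal_sup_ubound uB)) /ereal_inf_lt[_ [_ [y xy <-] <-]].
by rewrite dD2 lte_fin => h; exists y => //; exact: ltW.
Qed.

(** Points of [X] near two antipodal vectors of norm [D] are almost [2 * D] apart, so one of them is
    far from [x]. In particular [X] is unbounded. *)
Lemma flat_far x D : delta <= 40^-1 -> s0 < D -> exists2 e, D / 2 <= d x e & d x e <= D.
Proof.
move=> del sD; have D0 : 0 < D by exact: lt_trans s00 sD.
have [d0 dE dC dD] := d_met.
have [N [phi [N_norm phiD phid phis]]] := reifenberg_chart x sD.
have [N0 NE NZ ND] := N_norm.
have N1 : 0 < N (const_mx 1).
  rewrite lt_neqAle N0 andbT eq_sym; apply/eqP => /NE/rowP/(_ ord0)/eqP.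
  by rewrite !mxE oner_eq0.
pose u : V := (D / N (const_mx 1)) *: const_mx 1.
have uD : N u = D by rewrite NZ ger0_norm ?divr_ge0 ?(ltW D0)// divfK ?lt0r_neq0.
have [|y xy uy] := phis u; first by rewrite uD.
have [|z xz uz] := phis (- u); first by rewrite is_normN// uD.
have dd : delta * D <= 40^-1 * D by rewrite ler_pM2r.
have yz : 2 * D - 4 * delta * D <= N (phi y - phi z).
  have -> : 2 * D = N (u - (- u)).
    have -> : u - (- u) = 2 *: u by rewrite opprK scaler_nat mulr2n.
    by rewrite NZ uD ger0_norm.
  have := is_norm_triangle N_norm u (phi y) (- u).
  have := is_norm_triangle N_norm (phi y) (phi z) (- u).
  by move: uz; rewrite [N (- u - phi z)]is_normB//; lra.
have dyz : 2 * D - 6 * delta * D <= d y z.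
  by have := phid y z xy xz; rewrite ler_norml => /andP[? ?]; lra.
have [h|h] := leP (D / 2) (d x y); first by exists y.
exists z => //; have := dD y x z; rewrite [d y x]dC; lra.
Qed.

(** Flatness says nothing at scales up to [s0], so for small [D] the chart is taken at scale
    [2 * s0]; its error is still small relative to [D >= b]. *)
Lemma flat_midpoint b : 0 < b -> b <= s0 -> 80 * delta * s0 <= b ->
  forall q z D, b <= D -> d q z <= D ->
  exists w, d q w <= 3 / 4 * D /\ d w z <= 3 / 4 * D.
Proof.
move=> b0 bs db q z D bD qz.
have [d0 dE dC dD] := d_met.
pose D' := Num.max D (2 * s0).
have DD' : D <= D' by rewrite le_max lexx.
have sD' : s0 < D' by rewrite lt_max [X in _ || X](_ : _ = true) ?orbT//; have := s00; lra.
(* The errors add up to [5 * delta * D'], and [D / 2 + D / 4] is the announced bound. *)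
have eD' : 20 * delta * D' <= D.
  rewrite /D'; case: (leP D (2 * s0)) => h; have de0 := delta0; have s0_ := s00; first by lra.
  have : 80 * delta <= 1 by rewrite -(ler_pM2r s00); lra.
  move=> h'; have D0 : 0 < D by lra.
  have : 80 * delta * D <= 1 * D by rewrite ler_pM2r.
  lra.
have [N [phi [N_norm phiD phid phis]]] := reifenberg_chart q sD'.
have [N0 NE NZ ND] := N_norm.
have qq : d q q <= D' by rewrite (proj2 (dE q q) erefl); have := s00; lra.
have qz' : d q z <= D' by exact: le_trans qz DD'.
pose u := 2^-1 *: (phi q + phi z).
have uD : N u <= D'.
  rewrite NZ ger0_norm//; have := ND (phi q) (phi z); have := phiD _ qq; have := phiD _ qz'; lra.
have [w qw uw] := phis u uD; exists w.
have qzN : N (phi q - phi z) <= D + 2 * delta * D'.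
  by have := phid q z qq qz'; rewrite ler_norml => /andP[? ?]; lra.
have nh : `|2^-1 : R| = 2^-1 by rewrite ger0_norm.
have qu : N (phi q - u) = 2^-1 * N (phi q - phi z).
  rewrite -[X in X * _]nh -NZ; congr (N _); apply/rowP => j; rewrite !mxE; lra.
have uz : N (u - phi z) = 2^-1 * N (phi q - phi z).
  rewrite -[X in X * _]nh -NZ; congr (N _); apply/rowP => j; rewrite !mxE; lra.
have := phid q w qq qw; have := phid w z qw qz'; rewrite !ler_norml => /andP[_ h1] /andP[_ h2].
have := is_norm_triangle N_norm (phi q) u (phi w).
have := is_norm_triangle N_norm (phi w) u (phi z); rewrite [N (phi w - u)]is_normB//.
by split; lra.
Qed.

Lemma flat_cover b : 0 < b -> b <= s0 -> 80 * delta * s0 <= b ->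
  forall y D, b <= D -> exists s : seq T,
  forall z, d y z <= D -> exists2 v, List.In v s & d v z <= 3 / 4 * D.
Proof.
move=> b0 bs db y D bD.
have [d0 dE dC dD] := d_met.
pose D' := Num.max D (2 * s0).
have DD' : D <= D' by rewrite le_max lexx.
have sD' : s0 < D' by rewrite lt_max [X in _ || X](_ : _ = true) ?orbT//; have := s00; lra.
have eD' : 20 * delta * D' <= D.
  rewrite /D'; case: (leP D (2 * s0)) => h; have de0 := delta0; have s0_ := s00; first by lra.
  have : 80 * delta <= 1 by rewrite -(ler_pM2r s00); lra.
  move=> h'; have D0 : 0 < D by lra.
  have : 80 * delta * D <= 1 * D by rewrite ler_pM2r.
  lra.
have [N [phi [N_norm phiD phid phis]]] := reifenberg_chart y sD'.
have [|s sN] := @is_norm_net R n N N_norm D' (D / 8); first by lra.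
(* Net vectors close to no image of the ball are dropped; each of the others is traded for a point
   of the ball. *)
have [t tP] : exists t : seq T, forall u z, u \in s -> d y z <= D -> N (phi z - u) <= D / 8 ->
    exists2 v, List.In v t & d y v <= D /\ N (phi v - u) <= D / 8.
  elim: s {sN} => [|u s [t IH]]; first by exists [::].
  have [[v [yv uv]]|no] := pselect (exists v, d y v <= D /\ N (phi v - u) <= D / 8).
    exists (v :: t) => u' z; rewrite in_cons => /predU1P[->|u's] yz uz.
      by exists v => //; left.
    by have [v' v't hv'] := IH u' z u's yz uz; exists v' => //; right.
  exists t => u' z; rewrite in_cons => /predU1P[->|u's] yz uz; last exact: IH uz.
  by exfalso; apply: no; exists z.
exists t => z yz.
have yz' : d y z <= D' by exact: le_trans yz DD'.
have [u us uz] := sN _ (phiD _ yz').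
have [v vt [yv uv]] := tP u z us yz uz; exists v => //.
have yv' : d y v <= D' by exact: le_trans yv DD'.
have := phid v z yv' yz'; rewrite ler_norml => /andP[_ h].
have := is_norm_triangle N_norm (phi v) u (phi z); rewrite [N (u - _)]is_normB//.
by lra.
Qed.

End Flatness.

(** * Nets of John domains *)

Section Domain.
Context {R : realType} {T : Type}.
Variables (d : T -> T -> R) (b : R) (k : nat) (x : T).
Hypotheses (d_met : is_metric d) (b0 : 0 < b).
Hypothesis mid : forall q z D, b <= D -> d q z <= D ->
  exists w, d q w <= 3 / 4 * D /\ d w z <= 3 / 4 * D.

(** The ratio is the inverse of the contraction 3/4 of [mid], so that midpoints cut a jump of one
    level into two of the level below. *)
Definition scale (j : nat) : R := b * (4 / 3) ^+ j.

Lemma scaleS j : scale j.+1 = 4 / 3 * scale j.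
Proof. by rewrite /scale exprS mulrCA. Qed.

Lemma scale_ge j : b <= scale j.
Proof. by rewrite ler_peMr ?(ltW b0)// exprn_ege1//; lra. Qed.

Lemma scale_unbounded D : exists j, D <= scale j.
Proof.
exists (Num.truncn (3 * D / b)).+1.
have := truncnS_gt (3 * D / b); set j := (Num.truncn _).+1 => Dj.
rewrite /scale -ler_pdivrMl// mulrC.
have bern i : 1 + i%:R / 3 <= (4 / 3 : R) ^+ i.
  elim: i => [|i IH]; first by rewrite mul0r addr0 expr0.
  rewrite exprS -[i.+1%:R]natr1; have : 0 <= i%:R :> R by []; lra.
apply: le_trans (bern j); move: Dj; have -> : 3 * D / b = 3 * (D / b) by ring.
by lra.
Qed.

(* [john_domain i] consists of the endpoints of chains issued from [x] with [i]
   jumps of lengths at most [scale k], [scale k.-1], ..., so that every point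
   of [john_domain k] is, at each scale [scale j], close to a ball of that
   radius which is contained in [john_domain k]. *)
Fixpoint john_domain (i : nat) : set T :=
  if i is i'.+1 then [set z | exists2 q, john_domain i' q & d q z <= scale (k - i')]
  else [set x].

Lemma john_domain_subS i : john_domain i `<=` john_domain i.+1.
Proof.
move=> z iz; exists z => //; have [_ dE _ _] := d_met.
by rewrite (proj2 (dE z z) erefl) (le_trans _ (scale_ge _))// ltW.
Qed.

Lemma john_domain_sub i j : (i <= j)%N -> john_domain i `<=` john_domain j.
Proof.
elim: j => [|j IH]; first by rewrite leqn0 => /eqP ->.
rewrite leq_eqVlt => /predU1P[->//|ij].
exact: subset_trans (IH ij) (@john_domain_subS j).
Qed.

Lemma john_domain_ball i q z : (i < k)%N -> john_domain i q -> d q z <= scale (k - i) ->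
  john_domain k z.
Proof. by move=> ik iq qz; apply: (john_domain_sub ik); exists q. Qed.

(** Undoing the last [i] jumps moves the point by a geometric sum dominated by its largest term; the
    factor 4 is [1 / (1 - 3 / 4)]. *)
Lemma john_domain_center i z : (i <= k)%N -> john_domain k z ->
  exists2 q, john_domain (k - i) q & d q z <= 4 * scale i.
Proof.
have [_ dE _ dD] := d_met.
elim: i => [|i IH] ik kz.
  exists z; first by rewrite subn0.
  rewrite (proj2 (dE z z) erefl) mulr_ge0// (le_trans _ (scale_ge _))//; exact: ltW.
have [q] := IH (ltnW ik) kz; rewrite -(subnSK ik) => -[q' q'k q'q] qz.
exists q' => //; move: q'q; rewrite subKn// scaleS => q'q.
have := dD q' q z; lra.
Qed.

(** Impredicative form of the reflexive transitive closure of the steps inside [A] of length at most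
    [h]. *)
Definition chain_linked (A : set T) (h : R) (p q : T) := forall B : set T,
  B p -> (forall y z, A y -> A z -> B y -> d y z <= h -> B z) -> B q.

(** A midpoint of a jump from [q] is itself reached by an admissible jump from [q], so both halves
    are jumps of the next level. The last level has length [4 / 3 * b]. *)
Lemma john_domain_linked j q z : (j < k)%N -> john_domain (k - j.+1) q -> d q z <= scale j.+1 ->
  chain_linked (john_domain k) (2 * b) q z.
Proof.
elim: j q z => [|j IH] q z jk jq qz.
  have kz : john_domain k z.
    by apply: (john_domain_ball _ jq); rewrite ?subKn//; lia.
  move=> B Bq BS; apply: (BS q z) => //; first by apply: john_domain_sub jq; exact: leq_subr.
  by apply: le_trans qz _; rewrite scaleS /scale expr0; have := b0; lra.
have jq' : john_domain (k - j.+1) q by apply: john_domain_sub jq; lia.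
have [w []] := mid (scale_ge j.+2) qz.
have -> : 3 / 4 * scale j.+2 = scale j.+1 by rewrite scaleS; field.
move=> qw wz; move=> B Bq BS.
have jw : john_domain (k - j.+1) w.
  have -> : (k - j.+1 = (k - j.+2).+1)%N by lia.
  exists q => //; apply: le_trans qw _; rewrite subKn// [leRHS]scaleS.
  have := scale_ge j.+1; have := b0; lra.
apply: (IH w z) => //; first by lia.
by apply: (IH q w) => //; lia.
Qed.

Lemma john_domain_connected z : john_domain k z -> chain_linked (john_domain k) (2 * b) x z.
Proof.
suff key i y : (i <= k)%N -> john_domain i y -> chain_linked (john_domain k) (2 * b) x y.
  exact: key.
elim: i y => [|i IH] y ik; first by move=> -> B.
move=> [q iq qy] B Bx BS; apply: (@john_domain_linked (k - i).-1 q y) => //; first by lia.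
- by rewrite prednK ?subn_gt0// subKn// ltnW.
- by rewrite prednK ?subn_gt0.
exact: IH (ltnW ik) iq B Bx BS.
Qed.

End Domain.

(** * Finite separated nets *)

Section Nets.
Context {R : realType} {T : choiceType}.
Variables (d : T -> T -> R).
Hypotheses (d_met : is_metric d).

Lemma separated_subseq (h : R) (s : seq T) : 0 <= h -> exists F : seq T,
  [/\ uniq F, {subset F <= s},
      forall p q, p \in F -> q \in F -> p != q -> h < d p q &
      forall z, z \in s -> exists2 f, f \in F & d f z <= h].
Proof.
have [d0 dE dC dD] := d_met; move=> h0.
elim: s => [|z s [F [uF Fs Fsep Fnet]]]; first by exists [::].
have [[f fF fz]|far] := pselect (exists2 f, f \in F & d f z <= h).
  exists F; split=> // [p /Fs ps|y].
    by rewrite in_cons ps orbT.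
  by rewrite in_cons => /predU1P[->|/Fnet//]; exists f.
have far' f : f \in F -> h < d f z.
  by move=> fF; rewrite ltNge; apply/negP => fz; apply: far; exists f.
exists (z :: F); split=> /=.
- rewrite uF andbT; apply/negP => zF; have := far' z zF.
  by rewrite (proj2 (dE z z) erefl) ltNge h0.
- by move=> p; rewrite !in_cons => /predU1P[->|/Fs ->]; rewrite ?eqxx ?orbT.
- move=> p q; rewrite !in_cons => /predU1P[->|pF] /predU1P[->|qF].
  + by rewrite eqxx.
  + by move=> _; rewrite dC far'.
  + by move=> _; exact: far'.
  + exact: Fsep.
move=> y; rewrite in_cons => /predU1P[->|/Fnet[f fF fy]].
  by exists z; rewrite ?mem_head// (proj2 (dE z z) erefl).
by exists f; rewrite // in_cons fF orbT.
Qed.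

Lemma finite_cover (b : R) : 0 < b ->
  (forall y D, b <= D -> exists s : seq T,
    forall z, d y z <= D -> exists2 v, List.In v s & d v z <= 3 / 4 * D) ->
  forall y D, exists s : seq T,
    forall z, d y z <= D -> exists2 v, List.In v s & d v z <= b.
Proof.
move=> b0 cov.
have key j y : exists s : seq T,
    forall z, d y z <= scale b j -> exists2 v, List.In v s & d v z <= b.
  elim: j y => [|j IH] y.
    by exists [:: y] => z; rewrite /scale expr0 mulr1 => yz; exists y => //; left.
  have [s sy] := cov y _ (scale_ge b0 j.+1).
  have [t ts] : exists t : seq T, forall v z, List.In v s -> d v z <= scale b j ->
      exists2 u, List.In u t & d u z <= b.
    elim: s {sy} => [|v s [t IHt]]; first by exists [::].
    have [tv tvP] := IH v; exists (tv ++ t) => v' z [<-|v's] vz.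
      by have [u ut uz] := tvP z vz; exists u => //; apply: List.in_or_app; left.
    by have [u ut uz] := IHt v' z v's vz; exists u => //; apply: List.in_or_app; right.
  exists t => z /sy[v vs]; have -> : 3 / 4 * scale b j.+1 = scale b j by rewrite scaleS; field.
  exact: ts.
move=> y D; have [j Dj] := scale_unbounded b0 D.
have [s sP] := key j y; exists s => z yz; apply: sP; exact: le_trans yz Dj.
Qed.

(** The centres of the covering may lie outside [A]; trading them for points of [A] costs the factor
    2 in front of [b]. *)
Lemma finite_separated_net (A : set T) (s : seq T) (b h : R) : 0 < b -> 0 <= h ->
  (forall z, A z -> exists2 v, List.In v s & d v z <= b) ->
  exists F : seq T, [/\ uniq F, forall f, f \in F -> A f,
      forall p q, p \in F -> q \in F -> p != q -> h < d p q &
      forall z, A z -> exists2 f, f \in F & d f z <= h + 2 * b].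
Proof.
have [d0 dE dC dD] := d_met; move=> b0 h0 As.
have [t tA tnet] : exists2 t : seq T, forall f, f \in t -> A f &
    forall v z, List.In v s -> A z -> d v z <= b -> exists2 f, f \in t & d f z <= 2 * b.
  elim: s {As} => [|v s [t tA tnet]]; first by exists [::].
  have [[f Af vf]|no] := pselect (exists2 f, A f & d v f <= b).
    exists (f :: t) => [g|v' z [<-|v's] Az vz].
    - by rewrite in_cons => /predU1P[->//|/tA].
    - exists f; rewrite ?mem_head//; have := dD f v z; rewrite [d f v]dC; lra.
    - by have [g gt gz] := tnet v' z v's Az vz; exists g; rewrite // in_cons gt orbT.
  exists t => // v' z [<-|v's] Az vz; last exact: tnet vz.
  by exfalso; apply: no; exists z.
have [F [uF Ft Fsep Fnet]] := separated_subseq t h0.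
exists F; split=> // [f /Ft/tA//|z Az].
have [v vs vz] := As z Az; have [g gt gz] := tnet v z vs Az vz.
by have [f fF fg] := Fnet g gt; exists f => //; have := dD f g z; lra.
Qed.

End Nets.

Section DomainNet.
Context {R : realType} {T : choiceType}.
Variables (d : T -> T -> R) (b : R) (k : nat) (x : T).
Hypotheses (d_met : is_metric d) (b0 : 0 < b) (k0 : (0 < k)%N).
Hypothesis mid : forall q z D, b <= D -> d q z <= D ->
  exists w, d q w <= 3 / 4 * D /\ d w z <= 3 / 4 * D.
Hypothesis cov : forall y D, b / 2 <= D -> exists s : seq T,
  forall z, d y z <= D -> exists2 v, List.In v s & d v z <= 3 / 4 * D.

Lemma exists_domain_net : exists F : seq T,
  [/\ uniq F, forall p q, p \in F -> q \in F -> p != q -> 3 * b < d p q,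
      forall z, d x z <= scale b k -> exists2 f, f \in F & d f z <= 4 * b,
      forall f, f \in F -> d x f <= 4 * scale b k &
  [/\ forall f j, f \in F -> (0 < j <= k)%N -> exists2 q, d q f <= 4 * scale b j &
        forall z, d q z <= scale b j -> exists2 f', f' \in F & d f' z <= 4 * b &
      forall (V : seq T) v, {subset V <= F} -> v \in V -> ~~ all (mem V) F ->
        exists p q, [/\ p \in V, q \in F, q \notin V & d p q <= 10 * b]]].
Proof.
have [d0 dE dC dD] := d_met.
pose S := john_domain d b k x k.
have b20 : 0 < b / 2 by rewrite divr_gt0.
have xS z : S z -> d x z <= 4 * scale b k.
  move=> Sz; have [q] := john_domain_center d_met b0 (leqnn k) Sz.
  by rewrite subnn => ->.
have [s sP] := finite_cover b20 cov x (4 * scale b k).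
have h3 : 0 <= 3 * b by have := b0; lra.
(* With a covering at scale [b / 2] the net has radius [3 * b + 2 * (b / 2) = 4 * b]. *)
have [F [uF FS Fsep Fnet]] := @finite_separated_net _ _ d d_met S s _ _ b20 h3 (fun z Sz => sP z (xS z Sz)).
have Fnet4 z : S z -> exists2 f, f \in F & d f z <= 4 * b.
  by move=> /Fnet[f fF fz]; exists f => //; lra.
exists F; split=> //.
- move=> z xz; apply: Fnet4; apply: (john_domain_ball d_met b0 k0 (q := x)) => //.
  by rewrite subn0.
- by move=> f /FS/xS.
split.
  move=> f j fF /andP[j0 jk]; have [q qj qf] := john_domain_center d_met b0 jk (FS f fF).
  exists q => // z qz; apply: Fnet4; apply: (john_domain_ball d_met b0 _ qj).
    by rewrite ltn_subrL j0.
  by rewrite subKn.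
move=> V v VF vV nall.
have [//|none] := pselect (exists p q, [/\ p \in V, q \in F, q \notin V & d p q <= 10 * b]).
exfalso; move/negP: nall; apply; apply/allP => f fF /=.
have closed p q : p \in V -> q \in F -> d p q <= 10 * b -> q \in V.
  by move=> pV qF pq; apply/negPn/negP => qV; apply: none; exists p, q.
(* If no step of length [10 * b] leaves [V], its [4 * b]-neighbourhood is stable under steps of
   length [2 * b], as 10 = 4 + 2 + 4. *)
pose B := [set z | exists2 p, p \in V & d p z <= 4 * b].
have Bstep y z : S y -> S z -> B y -> d y z <= 2 * b -> B z.
  move=> Sy Sz [p pV py] yz; have [q qF qz] := Fnet4 z Sz; exists q => //.
  apply: closed pV qF _; have := dD p y q; have := dD y z q; rewrite [d z q]dC; lra.
have Bx : B x.
  (* Chains are only known to start at [x]: applied to the complement of [B], they put [x] in [B];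
     applied to [B], they then reach [f]. *)
  apply: contrapT => nBx; have : ~ B v.
    apply: (john_domain_connected d_met b0 mid (FS v (VF v vV)) (B := ~` B)) => // y z Sy Sz nBy yz Bz.
    by apply: nBy; apply: (Bstep z y) => //; rewrite dC.
  by apply; exists v => //; rewrite (proj2 (dE v v) erefl) mulr_ge0// ltW.
have [p pV pf] : B f.
  exact: (john_domain_connected d_met b0 mid (FS f fF)) Bx Bstep.
by apply: closed pV fF _; have := b0; lra.
Qed.

End DomainNet.

(** * Counting net points by regularity *)

Section AhlforsCounts.
Context {R : realType} {T : choiceType} {n : nat}.
Variables (d : T -> T -> R) (b C : R) (F : seq T).
Hypotheses (n0 : (0 < n)%N) (d_met : is_metric d) (b0 : 0 < b) (C0 : 0 < C) (uF : uniq F).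
Hypothesis Fsep : forall p q, p \in F -> q \in F -> p != q -> 3 * b < d p q.
Hypothesis regular : forall x r, 0 < r ->
  ((C^-1 * r ^+ n)%:E <= hausdorff_measure d n (cball d x r))%E /\
  (hausdorff_measure d n (cball d x r) <= (C * r ^+ n)%:E)%E.

(** Packing: the balls of radius [b] around net points are at distance at least [b] from each other
    and lie in the ball of radius [t + b]. *)
Lemma ahlfors_count_upper p t : 0 <= t ->
  (count (fun f => d p f <= t) F)%:R <= C ^+ 2 * ((t + b) / b) ^+ n.
Proof.
have [d0 dE dC dD] := d_met; move=> t0; have bb := b0; have CC := C0.
have tb : 0 < t + b by lra.
rewrite -size_filter; set Fp := seq.filter _ F.
have : (((size Fp)%:R * (C^-1 * b ^+ n))%:E <= (C * (t + b) ^+ n)%:E)%E.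
  apply: le_trans (regular p tb).2.
  apply: (@hausdorff_separated_seq _ _ d n n0 _ Fp (fun f => cball d f b) _ b) => //.
  - exact: filter_uniq.
  - move=> f g y z; rewrite !mem_filter /cball /= => /andP[_ fF] /andP[_ gF] fg fy gz.
    have := Fsep fF gF fg; have := dD f y g; have := dD y z g; rewrite [d z g]dC; lra.
  - move=> f; rewrite mem_filter /cball /= => /andP[pf _] z /= fz.
    by have := dD p f z; lra.
  by move=> f _; case: (regular f b0).
rewrite lee_fin => h.
have bn : 0 < b ^+ n by rewrite exprn_gt0.
rewrite expr_div_n mulrA ler_pdivlMr//.
have := ler_wpM2l (ltW CC) h.
by rewrite mulrCA mulVKf ?lt0r_neq0// mulrA -expr2.
Qed.

Lemma ahlfors_count_lower p q s t eta : 0 < s -> 0 < eta -> d p q + s + eta <= t ->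
  (forall z, d q z <= s -> exists2 f, f \in F & d f z <= eta) ->
  C^-1 ^+ 2 * (s / eta) ^+ n <= (count (fun f => d p f <= t) F)%:R.
Proof.
have [d0 dE dC dD] := d_met; move=> s0 e0 st net; have CC := C0.
rewrite -size_filter; set Fp := seq.filter _ F.
have : ((C^-1 * s ^+ n)%:E <= ((size Fp)%:R * (C * eta ^+ n))%:E)%E.
  apply: le_trans (regular q s0).1 _.
  apply: (@hausdorff_bigcup_seq _ _ d n n0 _ Fp (fun f => cball d f eta)) => [z qz|f _].
    have [f fF fz] := net z qz; exists f => //; rewrite mem_filter fF andbT.
    have := dD p q f; have := dD q z f; rewrite [d z f]dC; move: qz; rewrite /cball /=; lra.
  by case: (regular f e0).
rewrite lee_fin => h.
have en : 0 < eta ^+ n by rewrite exprn_gt0.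
rewrite expr_div_n mulrA ler_pdivrMr//.
have Ci : 0 <= C^-1 by rewrite invr_ge0 ltW.
have := ler_wpM2l Ci h.
have -> : C^-1 ^+ 2 * s ^+ n = C^-1 * (C^-1 * s ^+ n) by rewrite expr2 mulrA.
by rewrite [X in _ <= X -> _]mulrCA mulKf ?lt0r_neq0.
Qed.

End AhlforsCounts.

(** * The tube *)

Lemma path_dist (R : realType) (T : eqType) (d : T -> T -> R) (sg : R) (x0 : T) (W : seq T) :
  is_metric d -> path (fun p q => d p q <= sg) x0 W ->
  forall i j, (i <= j)%N -> (j <= size W)%N ->
  d (nth x0 (x0 :: W) i) (nth x0 (x0 :: W) j) <= (j%:R - i%:R) * sg.
Proof.
move=> [d0 dE dC dD] /(pathP x0) pW i; elim=> [|j IH].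
  by rewrite leqn0 => /eqP -> _; rewrite subrr mul0r (proj2 (dE _ _) erefl).
rewrite leq_eqVlt => /predU1P[-> _|ij jW].
  by rewrite subrr mul0r (proj2 (dE _ _) erefl).
have := IH ij (ltnW jW); have := pW j jW.
have := dD (nth x0 (x0 :: W) i) (nth x0 (x0 :: W) j) (nth x0 (x0 :: W) j.+1).
rewrite -[j.+1%:R]natr1 /=; lra.
Qed.

Lemma euclidean_norm_bounds (R : realType) (n : nat) (u : 'rV[R]_n.+1) :
  `|u| <= euclidean_norm u <= n.+1%:R * `|u|.
Proof.
rewrite /euclidean_norm; apply/andP; split.
  have [j ->] := rV_norm_coord u; rewrite -sqrtr_sqr ler_wsqrtr// (bigD1 j)//=.
  by rewrite lerDl sumr_ge0// => i _; rewrite sqr_ge0.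
rewrite -[leRHS]ger0_norm ?mulr_ge0// -sqrtr_sqr ler_wsqrtr// exprMn.
apply: (@le_trans _ _ (n.+1%:R * `|u| ^+ 2)).
  apply: (@le_trans _ _ (\sum_(i < n.+1) `|u| ^+ 2)).
    apply: ler_sum => i _; rewrite -[u 0 i ^+ 2]real_normK ?num_real//.
    by rewrite lerXn2r ?nnegrE// rV_coord_le_norm.
  by rewrite sumr_const card_ord mulr_natl.
by rewrite ler_wpM2r ?exprn_ge0// expr2 ler_peMl// ler1n.
Qed.

(** A number [t >= 0] lies between its square and its square root, in an order decided by comparison
    with 1. *)
Lemma bilipschitz_bi_holder (R : realType) (Y Z : Type) (dY : Y -> Y -> R) (dZ : Z -> Z -> R)
    (f : Y -> Z) (C : R) :
  1 <= C -> (forall x y, 0 <= dY x y) ->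
  (forall x y, C^-1 * dY x y <= dZ (f x) (f y) <= C * dY x y) -> bi_holder dY dZ 2^-1 f.
Proof.
move=> C1 d0 fC; exists C => // x y; have /andP[h1 h2] := fC x y.
have t0 := d0 x y; set t := dY x y in t0 h1 h2 *.
have C0 : 0 < C by lra.
have ht : Num.min (t `^ 2^-1^-1) (t `^ 2^-1) <= t <= Num.max (t `^ 2^-1^-1) (t `^ 2^-1).
  rewrite invrK ge_min le_max (powR_mulrn 2 t0).
  have [t1|t1] := leP t 1.
    have -> : t ^+ 2 <= t by rewrite ler_iXnr.
    rewrite /= -{3}[t](powRr1 t0) orbC; apply/orP; left.
    have [->|tn0] := eqVneq t 0; first by rewrite !powR0 ?invr_eq0//; exact/eqP.
    apply: ger_powR; last by rewrite invf_le1//; lra.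
    by rewrite lt_neqAle eq_sym tn0 t0.
  have -> : t <= t ^+ 2 by rewrite ler_eXnr// ltW.
  rewrite /= andbT; apply/orP; right.
  by rewrite -{2}[t](powRr1 t0) ler_powR ?(ltW t1)// invf_le1//; lra.
case/andP: ht => ht1 ht2; split.
  by apply: le_trans h1; rewrite ler_pM2l ?invr_gt0.
by apply: le_trans h2 _; rewrite ler_pM2l.
Qed.

Section Tube.
Context {R : realType} {n : nat} {T : choiceType}.
Variables (d : T -> T -> R) (sg : R) (x0 : T) (W : seq T).
Hypotheses (d_met : is_metric d) (sg0 : 0 < sg) (W0 : (0 < size W)%N).
Hypothesis walk : path (fun p q => d p q <= sg) x0 W.
Local Notation V := 'rV[R]_n.+1.

Definition tube_length : R := (size W)%:R * sg.
Local Notation L := tube_length.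
Local Notation m := (bottle_dist sg L : V -> V -> R).

Definition tube_mark (i : 'I_(size W).+1) : V := bottle_axis (i%:R * sg).
Definition tube_label (i : 'I_(size W).+1) : T := nth x0 (x0 :: W) i.
Local Notation a := tube_mark.
Local Notation w := tube_label.

Definition tube_dist : V -> V -> R := glue m d a w sg.
Local Notation rho := tube_dist.

Lemma sg_le_L : sg <= L.
Proof. by rewrite ler_peMl ?(ltW sg0)// ler1n. Qed.

Lemma bottle_metric : is_metric m.
Proof.
split=> [u v|u v|u v|u v z].
- exact: bottle_dist_ge0.
- split=> [uv|->]; last exact: bottle_dist_xx.
  have := @norm_le_bottle_dist R n sg L sg0 sg_le_L u v.
  by rewrite uv mulr0 normr_le0 subr_eq0 => /eqP.
- exact: bottle_dist_sym.
- exact: bottle_dist_triangle.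
Qed.

Lemma tube_mark_dist i j : m (a i) (a j) = `|i%:R - j%:R| * sg.
Proof.
rewrite bottle_axis_dist ?mulr_ge0 ?(ltW sg0)//; last exact: sg_le_L.
by rewrite -mulrBl normrM (gtr0_norm sg0).
Qed.

Lemma tube_label_dist i j : d (w i) (w j) <= m (a i) (a j).
Proof.
have [_ _ dC _] := d_met; rewrite tube_mark_dist.
wlog ij : i j / (i <= j)%N.
  move=> wl; have [|/ltnW] := leqP i j; first exact: wl.
  by move=> ji; rewrite dC distrC; exact: wl.
rewrite distrC ger0_norm ?subr_ge0 ?ler_nat//.
exact: (path_dist d_met walk ij (ltn_ord j)).
Qed.

Lemma tube_metric : is_metric rho.
Proof. exact: glue_metric bottle_metric d_met sg0 tube_label_dist. Qed.

Lemma tube_le u v : rho u v <= m u v.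
Proof. exact: glue_le. Qed.

Lemma tube_local u v : rho u v < sg -> rho u v = m u v.
Proof. exact: glue_local bottle_metric d_met u v. Qed.

Lemma tube_mark_le i j : rho (a i) (a j) <= sg + d (w i) (w j).
Proof. exact: glue_mark_le bottle_metric i j. Qed.

Lemma tube_mark_ge i j : d (w i) (w j) <= rho (a i) (a j).
Proof. exact: glue_mark_ge bottle_metric d_met sg0 tube_label_dist i j. Qed.

Lemma tube_bi_holder : bi_holder_equivalent_to_norm rho euclidean_norm.
Proof.
exists 2^-1; first by apply/andP; split; [rewrite invr_gt0|rewrite invf_lt1//; lra].
have s0 := sg0; have sL := sg_le_L.
have [r0 _ _ _] := tube_metric.
pose M := L + sg.
have low u v : sg / (2 * M) * m u v <= rho u v.
  apply: (@glue_lower _ _ _ _ m d a w sg bottle_metric d_met sg0 M) => [|i j]; first by rewrite /M; lra.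
  rewrite tube_mark_dist /M; apply: (@le_trans _ _ L); last by lra.
  rewrite ler_pM2r// ler_norml.
  have hi : i%:R <= (size W)%:R :> R by rewrite ler_nat -ltnS.
  have hj : j%:R <= (size W)%:R :> R by rewrite ler_nat -ltnS.
  have i0 : 0 <= i%:R :> R by []. have j0 : 0 <= j%:R :> R by [].
  by apply/andP; split; lra.
have M0 : 0 < 2 * M by rewrite /M; lra.
have c0 : 0 < sg / (2 * M) by rewrite divr_gt0.
set c := sg / (2 * M) in low c0.
pose K := n.+1%:R * (3 * (L / sg)) / c.
have L0 : 0 <= L by lra.
have Ls : 0 <= L / sg by rewrite divr_ge0// ltW.
have K0 : 0 <= K.
  by apply: divr_ge0 (ltW c0); apply: mulr_ge0 => //; exact: mulr_ge0.
exists id; first by move=> z; exists z.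
apply: (@bilipschitz_bi_holder _ _ _ _ _ _ (3 + K)) => // [|u v]; first by lra.
rewrite /norm_dist; have /andP[e1 e2] := euclidean_norm_bounds (u - v).
have mu := @bottle_dist_le_norm R n sg L sg0 sL u v.
have um := @norm_le_bottle_dist R n sg L sg0 sL u v.
have le := tube_le u v; have lo := low u v; have rr := r0 u v.
apply/andP; split.
  rewrite ler_pdivrMl; last by lra.
  have : 0 <= K * euclidean_norm (u - v) by rewrite mulr_ge0// (le_trans _ e1).
  lra.
apply: le_trans e2 _; apply: (@le_trans _ _ (K * rho u v)); last by rewrite ler_wpM2r//; lra.
have mr : m u v <= rho u v / c by rewrite ler_pdivlMr// mulrC.
have -> : K * rho u v = n.+1%:R * (3 * (L / sg) * (rho u v / c)) by rewrite /K; ring.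
rewrite ler_wpM2l//; apply: le_trans um _.
by apply: ler_wpM2l mr; exact: mulr_ge0.
Qed.

Lemma tube_near_mark (v : V) : `|v| <= L -> exists i, m v (a i) <= 2 * sg.
Proof.
move=> vL; have s0 := sg0; pose i := Num.truncn (`|v| / sg).
have /andP[i1 i2] : i%:R <= `|v| / sg < i.+1%:R by rewrite truncn_itv// divr_ge0// ltW.
move: i1 i2; rewrite ler_pdivlMr// ltr_pdivrMr// -[i.+1%:R]natr1 => i1 i2.
have iW : (i < (size W).+1)%N.
  by rewrite ltnS -(ler_nat R) -(ler_pM2r sg0) (le_trans i1).
exists (Ordinal iW); apply: bottle_dist_axis_tube => //=; first exact: sg_le_L.
- by rewrite mulr_ge0// ltW.
- exact: le_trans i1 vL.
- by rewrite ger0_norm ?subr_ge0//; lra.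
Qed.

Lemma tube_mark0 : a ord0 = 0.
Proof. by rewrite /a mul0r; exact: bottle_axis0. Qed.

Lemma tube_label0 : w ord0 = x0.
Proof. by []. Qed.

Lemma tube_label_max : w ord_max = last x0 W.
Proof. by rewrite /w /= (last_nth x0). Qed.

(** After a shortcut to mark [j] there remains a height of at least [L - j * sg] to climb, and the
    rest of the walk shows that this is at least [d (w j) (last x0 W)]. *)
Lemma tube_exit u : L <= `|u| -> d x0 (last x0 W) <= rho 0 u.
Proof.
move=> Lu; rewrite -tube_mark0 -tube_label_max -tube_label0.
have [j] := glue_from_mark bottle_metric d_met sg0 tube_label_dist ord0 u.
apply: le_trans; have [_ _ _ dD] := d_met.
apply: le_trans (dD _ (w j) _) _; rewrite lerD2l.
apply: le_trans (tube_label_dist _ _) _; rewrite tube_mark_dist.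
have jW : j%:R <= (size W)%:R :> R by rewrite ler_nat -ltnS.
have := bottle_dist_norm sg L (a j) u; rewrite bottle_axis_norm ?mulr_ge0 ?(ltW sg0)//.
apply: le_trans; rewrite distrC [leRHS]distrC !ger0_norm ?subr_ge0//.
- by rewrite mulrBl lerD2r.
- by apply: le_trans Lu; rewrite ler_pM2r.
Qed.

End Tube.

(** * Ahlfors regularity of the tube *)

Lemma count_multiplicity (R : realDomainType) (T : eqType) (P : pred T) (F W : seq T) (M : R) :
  {subset W <= F} -> (forall p, (count_mem p W)%:R <= M) ->
  (count P W)%:R <= (count P F)%:R * M.
Proof.
move=> WF WM.
have : (count P W <= \sum_(f <- F | P f) count_mem f W)%N.
  elim: W WF {WM} => [|w W IH] WF //=.
  have wF : w \in F by apply: WF; rewrite mem_head.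
  under eq_bigr do rewrite /= eq_sym.
  rewrite big_split /= leq_add//; last by apply: IH => z zW; apply: WF; rewrite in_cons zW orbT.
  case Pw : (P w) => //; rewrite (big_rem w)//= Pw eqxx.
  exact: leq_addr.
rewrite -(ler_nat R) => /le_trans; apply; rewrite natr_sum.
apply: (@le_trans _ _ (\sum_(f <- F | P f) M)); first exact: ler_sum.
by rewrite big_const_seq iter_addr_0 mulr_natl.
Qed.

Definition hausdorff_upper_constant (R : realType) (r : nat) : R :=
  unit_ball_volume R r / 2 ^+ r * ((2 * r)%:R * 3 ^+ r).

(** 14 = 2 * 7: a ball of radius [t] contains a chart cube of side [t / 2], and [cube_cover] loses
    7. *)
Definition hausdorff_lower_constant (R : realType) (r : nat) : R :=
  unit_ball_volume R r / 2 ^+ r / 14 ^+ r.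

Lemma hausdorff_upper_constant_gt0 (R : realType) (r : nat) : (0 < r)%N ->
  0 < hausdorff_upper_constant R r.
Proof. by move=> r0; rewrite mulr_gt0 ?cn_gt0// mulr_gt0// ?exprn_gt0// ltr0n muln_gt0. Qed.

Lemma hausdorff_lower_constant_gt0 (R : realType) (r : nat) : 0 < hausdorff_lower_constant R r.
Proof. by rewrite divr_gt0 ?cn_gt0// exprn_gt0. Qed.

Section TubeHausdorff.
Context {R : realType} {n : nat} {T : choiceType}.
Variables (d : T -> T -> R) (sg : R) (x0 : T) (W : seq T).
Hypotheses (d_met : is_metric d) (sg0 : 0 < sg) (W0 : (0 < size W)%N).
Hypothesis walk : path (fun p q => d p q <= sg) x0 W.
Local Notation V := 'rV[R]_n.+1.
Local Notation L := (tube_length sg W).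
Local Notation m := (bottle_dist sg L : V -> V -> R).
Local Notation rho := (tube_dist d sg x0 W : V -> V -> R).
Local Notation H := (hausdorff_measure rho n.+1).
Local Notation a := (@tube_mark R n T sg W).
Local Notation w := (@tube_label T x0 W).

Local Notation c1 := (hausdorff_upper_constant R n.+1).
Local Notation c2 := (hausdorff_lower_constant R n.+1).

Lemma bottle_ball_upper u t : 0 < t -> (H [set v | m u v <= t]%R <= (c1 * t ^+ n.+1)%:E)%E.
Proof.
move=> t0.
have -> : c1 * t ^+ n.+1 =
    unit_ball_volume R n.+1 / 2 ^+ n.+1 * ((2 * n.+1)%:R * (3 * t) ^+ n.+1).
  by rewrite /hausdorff_upper_constant exprMn !mulrA.
apply: (hausdorff_le_cover (ltn0Sn n) t0) => h h0 ht.
have [N [G [Gcov Gh GN]]] := bottle_ball_cover sg0 (sg_le_L sg0 W0) u t0 h0 ht.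
exists N, G; split=> // i _; apply/diam_leP; first exact: ltW.
move=> x y Gx Gy; apply: le_trans (Gh i x y Gx Gy).
exact: tube_le.
Qed.

Lemma tube_ball_lower u t : 0 < t -> t <= 2 * sg \/ L <= `|u| ->
  ((c2 * t ^+ n.+1)%:E <= H (cball rho u t))%E.
Proof.
move=> t0 tu.
have [i [c ic]] := bottle_ball_cube sg0 (sg_le_L sg0 W0) t0 tu.
have t20 : 0 < t / 2 by rewrite divr_gt0.
apply: (@le_trans _ _ (H [set v | m u v <= t]%R)); last first.
  by apply: hausdorff_mono => v /= uv; exact: le_trans (tube_le _ _ _ _ _ _) uv.
have -> : c2 * t ^+ n.+1 = unit_ball_volume R n.+1 / 2 ^+ n.+1 * (t / 2 / 7) ^+ n.+1.
  rewrite /hausdorff_lower_constant (_ : t / 2 / 7 = t / 14); last by field.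
  by rewrite expr_div_n mulrA mulrAC.
apply: (hausdorff_ge_cube (ltn0Sn n) sg0 t20) ic => x y _ _ xy.
by rewrite (tube_local d_met sg0 W0 xy); exact: bottle_chart_lip.
Qed.

Section Regularity.
Variables (b C : R) (k : nat) (F : seq T).
Hypotheses (b0 : 0 < b) (sgb : sg = 10 * b) (C1 : 1 <= C) (k0 : (0 < k)%N).
Hypotheses (uF : uniq F) (WF : x0 :: W =i F).
Hypothesis Fsep : forall p q, p \in F -> q \in F -> p != q -> 3 * b < d p q.
Hypothesis Fdiam : forall p q, p \in F -> q \in F -> d p q <= 8 * scale b k.
Hypothesis Fball : forall f j, f \in F -> (0 < j <= k)%N -> exists2 q, d q f <= 4 * scale b j &
  forall z, d q z <= scale b j -> exists2 f', f' \in F & d f' z <= 4 * b.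
Hypothesis Wmult : forall p,
  (count_mem p (x0 :: W) <= 2 * (1 + count (fun q => d p q <= sg)%R F))%N.
Hypothesis regular : forall x r, 0 < r ->
  ((C^-1 * r ^+ n.+1)%:E <= hausdorff_measure d n.+1 (cball d x r))%E /\
  (hausdorff_measure d n.+1 (cball d x r) <= (C * r ^+ n.+1)%:E)%E.

(** The terms 1 and [3 ^+ r] bound the parts reached without a shortcut and on the flat end. The
    last one bounds the tube: 11 is [(sg + b) / b] in the degree of the net, and 140 = 7 * 20
    combines the count at radius [7 * t] with pieces of radius [2 * sg = 20 * b]. *)
Definition tube_upper_constant (r : nat) (K : R) : R :=
  hausdorff_upper_constant R r *
  (1 + 3 ^+ r + 2 * K ^+ 2 * (1 + K ^+ 2 * 11 ^+ r) * 140 ^+ r).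

Lemma tube_label_in i : w i \in F.
Proof. by rewrite -WF; apply: mem_nth; rewrite /= ltn_ord. Qed.

Lemma tube_label_count (P : pred T) :
  (size (seq.filter (fun i => P (w i)) (enum 'I_(size W).+1)))%:R <=
  (count P F)%:R * (2 * (1 + C ^+ 2 * 11 ^+ n.+1)) :> R.
Proof.
have CC : 0 < C by have := C1; lra.
have -> : size (seq.filter (fun i => P (w i)) (enum 'I_(size W).+1)) = count P (x0 :: W).
  rewrite size_filter -(count_map w P); congr count.
  apply: (@eq_from_nth _ x0); first by rewrite size_map size_enum_ord.
  move=> i; rewrite size_map size_enum_ord => iW.
  by rewrite (nth_map ord0) ?size_enum_ord// /tube_label nth_enum_ord.
apply: count_multiplicity => [p|p]; first by rewrite WF.
apply: (@le_trans _ _ (2 * (1 + (count (fun q => d p q <= sg) F)%:R))).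
  apply: (@le_trans _ _ ((2 * (1 + count (fun q => d p q <= sg)%R F))%N%:R)).
    by rewrite ler_nat; exact: Wmult.
  by rewrite natrM natrD.
rewrite ler_pM2l// lerD2l.
have := ahlfors_count_upper (ltn0Sn n) d_met b0 CC uF Fsep regular p (ltW sg0).
have -> : (sg + b) / b = 11 by rewrite sgb; field; rewrite lt0r_neq0.
by [].
Qed.

Lemma tube_upper u t : 0 < t ->
  (H (cball rho u t) <= (tube_upper_constant n.+1 C * t ^+ n.+1)%:E)%E.
Proof.
move=> t0; have s0 := sg0; have bb := b0; have CC : 0 < C by have := C1; lra.
have [r0 rE rC rD] : is_metric rho by exact: tube_metric.
have [d0 dE dC dD] := d_met.
have c10 : 0 < c1 := hausdorff_upper_constant_gt0 R (ltn0Sn n).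
have tn : 0 < t ^+ n.+1 by rewrite exprn_gt0.
pose Q := 2 * C ^+ 2 * (1 + C ^+ 2 * 11 ^+ n.+1) * 140 ^+ n.+1.
have Q0 : 0 <= Q by rewrite /Q !mulr_ge0// ?exprn_ge0// ?addr_ge0 ?mulr_ge0 ?exprn_ge0// ltW.
have -> : tube_upper_constant n.+1 C * t ^+ n.+1 =
    c1 * t ^+ n.+1 + (c1 * (3 * t) ^+ n.+1 + c1 * Q * t ^+ n.+1).
  by rewrite /tube_upper_constant -/Q exprMn; ring.
have [tsg|sgt] := ltP t sg.
  apply: (@le_trans _ _ (c1 * t ^+ n.+1)%:E); last first.
    rewrite lee_fin lerDl; apply: addr_ge0; apply: mulr_ge0; rewrite ?(ltW tn) ?(ltW c10)//.
      by apply: exprn_ge0; lra.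
    by rewrite mulr_ge0// ltW.
  apply: le_trans (bottle_ball_upper u t0); apply: hausdorff_mono => v /= uv.
  by rewrite -(tube_local d_met sg0 W0 (le_lt_trans uv tsg)).
(* [B2] contains the points of the flat end reached by a shortcut: they are at height at most
   [L + t], and [2 * sg <= 2 * t] accounts for the section. *)
pose B1 := [set v | m u v <= t]%R; pose B2 := [set v | m (a ord_max) v <= 3 * t]%R.
pose B3 := [set v | rho u v <= t /\ `|v| <= L]%R.
apply: (@le_trans _ _ (H (B1 `|` (B2 `|` B3)))).
  apply: hausdorff_mono => v; rewrite /cball /= => uv.
  have [vL|Lv] := leP `|v| L; first by right; right.
  have [e|[i [j e]]] := glueP m d a w sg u v; first by left; rewrite /B1 /= -e; exact: uv.
  have : glue m d a w sg u v <= t by exact: uv.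
  rewrite e => uv'; right; left.
  have h0 := bottle_dist_ge0 sg L u (a i); have h1 := d0 (w i) (w j).
  have mv : m (a j) v <= t by lra.
  have aL : m v (a ord_max) <= `|v| - L + 2 * sg.
    exact: (bottle_dist_axis_end sg0 (sg_le_L sg0 W0) (ltW Lv)).
  have := bottle_dist_norm sg L (a j) v; rewrite /B2 /= [m (a ord_max) v]bottle_dist_sym.
  have aj : `|a j| <= L.
    rewrite /tube_mark bottle_axis_norm ?mulr_ge0 ?(ltW sg0)// /tube_length ler_pM2r//.
    by rewrite ler_nat -ltnS.
  by rewrite distrC ger0_norm ?subr_ge0 ?(le_trans aj (ltW Lv))//; lra.
apply: le_trans (hausdorff_setU _ _ _ _) _; rewrite EFinD leeD//.
  exact: bottle_ball_upper.
apply: le_trans (hausdorff_setU _ _ _ _) _; rewrite EFinD leeD//.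
  by apply: bottle_ball_upper; rewrite mulr_gt0.
have [[v0 [uv0 v0L]]|no] := pselect (exists v, B3 v); last first.
  have -> : B3 = set0 by rewrite -subset0 => v vB; apply: no; exists v.
  rewrite hausdorff_set0// lee_fin; apply: mulr_ge0 (ltW tn).
  by apply: mulr_ge0 => //; exact: ltW.
have [i0 i0v] := tube_near_mark sg0 W0 v0L.
(* Two marks near points of the ball are at distance at most [2 * t + 4 * sg <= 6 * t]. *)
pose P q := d (w i0) q <= 6 * t.
pose s := seq.filter (fun j => P (w j)) (enum 'I_(size W).+1).
have sz : (size s)%:R <= C ^+ 2 * ((7 * t) / b) ^+ n.+1 * (2 * (1 + C ^+ 2 * 11 ^+ n.+1)).
  apply: le_trans (tube_label_count P) _; apply: ler_wpM2r.
    by rewrite mulr_ge0// addr_ge0// mulr_ge0// ?exprn_ge0// ltW.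
  have t60 : 0 <= 6 * t by lra.
  apply: le_trans (ahlfors_count_upper (ltn0Sn n) d_met b0 CC uF Fsep regular _ t60) _.
  rewrite ler_pM2l ?exprn_gt0// lerXn2r ?nnegrE ?divr_ge0 ?(ltW b0)//; try lra.
  rewrite ler_pM2r ?invr_gt0//; have := sgb; lra.
apply: (@le_trans _ _ ((size s)%:R * (c1 * (2 * sg) ^+ n.+1))%:E).
  apply: (hausdorff_bigcup_seq (ltn0Sn n) (A := fun j => [set v | m (a j) v <= 2 * sg]%R)) => [v [uv vL]|j _].
    have [j jv] := tube_near_mark sg0 W0 vL.
    exists j; last by rewrite /= bottle_dist_sym.
    rewrite mem_filter mem_enum andbT /P.
    apply: le_trans (tube_mark_ge d_met sg0 W0 walk i0 j) _.
    have := rD (a i0) v0 (a j); have := rD v0 u (a j); have := rD u v (a j).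
    have := tube_le d sg x0 W v0 (a i0); have := tube_le d sg x0 W v (a j).
    rewrite [rho (a i0) v0]rC [rho v0 u]rC; lra.
  by apply: bottle_ball_upper; rewrite mulr_gt0.
rewrite lee_fin; apply: le_trans (ler_wpM2r _ sz) _.
  by rewrite mulr_ge0 ?(ltW c10)// exprn_ge0// mulr_ge0// ltW.
have -> : 2 * sg = 20 * b by rewrite sgb; ring.
rewrite /Q (_ : 140 = 7 * 20 :> R); last by ring.
rewrite [(7 * t / b) ^+ _]exprMn exprVn !exprMn.
have bn : b ^+ n.+1 != 0 by rewrite expf_neq0// lt0r_neq0.
rewrite le_eqVlt; apply/orP; left; apply/eqP.
by field.
Qed.

Lemma scale_between t : 20 * scale b 1 <= t -> t < 20 * scale b k ->
  exists2 j, (0 < j <= k)%N & 20 * scale b j <= t /\ t < 20 * scale b j.+1.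
Proof.
move=> t1; elim: k k0 => [//|[|i] IH] _ tk; first by have := lt_le_trans tk t1; rewrite ltxx.
have [h|h] := ltP t (20 * scale b i.+1).
  by have [j /andP[j0 jk] jt] := IH isT h; exists j => //; rewrite j0 leqW.
by exists i.+1 => //=; exact: leqnSn.
Qed.

(** 107 exceeds 320/3, the factor between [scale b j / 4] and [20 * scale b j.+1], which is the
    largest loss among all cases. *)
Definition tube_lower_constant (r : nat) (K : R) : R :=
  hausdorff_lower_constant R r / (K ^+ 2 * 107 ^+ r).

Lemma tube_lower u t : 0 < t ->
  ((tube_lower_constant n.+1 C * t ^+ n.+1)%:E <= H (cball rho u t))%E.
Proof.
move=> t0; have s0 := sg0; have bb := b0; have CC : 0 < C by have := C1; lra.
have sE := sgb.
have [r0 rE rC rD] : is_metric rho by exact: tube_metric.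
have [d0 dE dC dD] := d_met.
have c20 : 0 < c2 := hausdorff_lower_constant_gt0 R n.+1.
have tn : 0 < t ^+ n.+1 by rewrite exprn_gt0.
have C21 : 1 <= C ^+ 2 by exact: exprn_ege1.
have C20 : 0 < C ^+ 2 by exact: exprn_gt0.
have bk : b <= scale b k by exact: scale_ge.
(* It suffices to find in the ball another one of comparable radius to which [tube_ball_lower]
   applies. *)
have weaken t' : 0 < t' -> t <= 107 * t' -> forall z, t' <= 2 * sg \/ L <= `|z| ->
    cball rho z t' `<=` cball rho u t ->
    ((tube_lower_constant n.+1 C * t ^+ n.+1)%:E <= H (cball rho u t))%E.
  move=> t'0 tt' z zt' zu; apply: le_trans (hausdorff_mono _ _ zu).
  apply: le_trans (tube_ball_lower t'0 zt'); rewrite lee_fin.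
  rewrite /tube_lower_constant -mulrA ler_pM2l//.
  rewrite mulrC ler_pdivrMr; last by rewrite mulr_gt0// exprn_gt0.
  apply: (@le_trans _ _ ((107 * t') ^+ n.+1)); first by rewrite lerXn2r ?nnegrE//; lra.
  rewrite exprMn mulrC [leRHS]mulrCA -[leLHS]mul1r ler_wpM2r// mulr_ge0// exprn_ge0//.
  exact: ltW.
have [t2|t2] := leP t (2 * sg).
  by apply: (weaken t t0 _ u (or_introl t2)); first lra.
have [Lu|uL] := leP L `|u|.
  by apply: (weaken t t0 _ u (or_intror Lu)); first lra.
have [t100|t100] := leP t (100 * sg).
  apply: (weaken (2 * sg) _ _ u (or_introl (lexx _))); rewrite ?mulr_gt0//; first by lra.
  by move=> v /= uv; apply: le_trans uv (ltW t2).
have [i0 ui0] := tube_near_mark sg0 W0 (ltW uL).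
have ui : rho u (a i0) <= 2 * sg by apply: le_trans ui0; exact: tube_le.
(* At radii beyond the size of the net, the ball reaches the last mark and contains a ball of half
   its radius centred at the start of the flat end. *)
have [tk|tk] := leP (20 * scale b k) t.
  have ue : rho u (a ord_max) <= t / 2.
    have := rD u (a i0) (a ord_max); have := @tube_mark_le R n T d sg x0 W sg0 W0 i0 (@ord_max (size W)).
    have := Fdiam (tube_label_in i0) (tube_label_in ord_max); lra.
  apply: (weaken (t / 2) _ _ (a ord_max)); rewrite ?divr_gt0//; first by lra.
    by right; rewrite /tube_mark bottle_axis_norm// mulr_ge0// ltW.
  move=> v; rewrite /cball /= => av; have := rD u (a ord_max) v; lra.
have [j jk [jt tj]] : exists2 j, (0 < j <= k)%N & 20 * scale b j <= t /\ t < 20 * scale b j.+1.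
  by apply: scale_between => //; rewrite scaleS /scale expr0; lra.
have bj : b <= scale b j by exact: scale_ge.
have [q qf qball] := Fball (tube_label_in i0) jk.
pose t' := 5 * scale b j + 4 * b.
have sj0 : 0 < scale b j by lra.
have b40 : 0 < 4 * b by lra.
have t'P : d (w i0) q + scale b j + 4 * b <= t' by rewrite dC /t'; lra.
have cnt := ahlfors_count_lower (ltn0Sn n) d_met CC regular sj0 b40 t'P qball.
pose s := seq.filter (fun f => d (w i0) f <= t') F.
rewrite -size_filter -/s in cnt.
have idx f : exists i, f \in F -> w i = f.
  have [fF|fF] := boolP (f \in F); last by exists ord0.
  have fW : (index f (x0 :: W) < (size W).+1)%N by rewrite -[X in (_ < X)%N]/(size (x0 :: W)) index_mem WF.
  by exists (Ordinal fW) => _; rewrite /tube_label nth_index// WF.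
have [I IP] := choice idx.
have sF f : f \in s -> f \in F by rewrite mem_filter => /andP[].
apply: (@le_trans _ _ ((size s)%:R * (c2 * b ^+ n.+1))%:E).
  rewrite lee_fin; apply: le_trans (ler_wpM2r _ cnt); last first.
    by apply: mulr_ge0 (ltW c20) _; rewrite exprn_ge0// ltW.
  have st : t <= 107 * (scale b j / 4) by move: tj; rewrite scaleS; lra.
  have -> : C^-1 ^+ 2 * (scale b j / (4 * b)) ^+ n.+1 * (c2 * b ^+ n.+1) =
      C^-1 ^+ 2 * c2 * (scale b j / 4) ^+ n.+1.
    rewrite [scale b j / (4 * b)](_ : _ = scale b j / 4 / b); last by field; rewrite lt0r_neq0.
    rewrite expr_div_n; have : b ^+ n.+1 != 0 by rewrite expf_neq0// lt0r_neq0.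
    by move=> bn; field; rewrite bn lt0r_neq0.
  have -> : tube_lower_constant n.+1 C * t ^+ n.+1 = C^-1 ^+ 2 * c2 * (t / 107) ^+ n.+1.
    rewrite /tube_lower_constant expr_div_n; have : (107 : R) ^+ n.+1 != 0 by rewrite expf_neq0.
    by move: c2 => c n107; field; rewrite n107 lt0r_neq0.
  have Cc : 0 < C^-1 ^+ 2 * c2 by apply: mulr_gt0 => //; rewrite exprn_gt0// invr_gt0.
  rewrite ler_pM2l//.
  by rewrite lerXn2r ?nnegrE//; lra.
(* One mark is selected for each net point; marks of distinct net points are more than [3 * b]
   apart, so their balls of radius [b] are separated. *)
apply: (@hausdorff_separated_seq _ _ rho n.+1 (ltn0Sn n) _ s (fun f => cball rho (a (I f)) b) _ b) => //.
- exact: filter_uniq.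
- move=> f g y z fs gs fg; rewrite /cball /= => fy gz.
  have := @tube_mark_ge R n T d sg x0 W d_met sg0 W0 walk (I f) (I g).
  rewrite !IP ?sF//; have := Fsep (sF _ fs) (sF _ gs) fg.
  have := rD (a (I f)) y (a (I g)); have := rD y z (a (I g)); rewrite [rho z _]rC; lra.
- move=> f fs v; rewrite /cball /= => fv.
  have := @tube_mark_le R n T d sg x0 W sg0 W0 i0 (I f); rewrite IP ?sF//.
  move: fs; rewrite mem_filter /t' => /andP[df _].
  have := rD u (a i0) v; have := rD (a i0) (a (I f)) v; lra.
by move=> f _; apply: tube_ball_lower => //; left; lra.
Qed.

End Regularity.
End TubeHausdorff.

Lemma mdist_metric (R : realType) (X : metricType R) : is_metric (@mdist R X).
Proof.
split=> [x y|x y|x y|x y z].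
- exact: mdist_ge0.
- by split=> [/mdist_positivity//|->]; rewrite mdistxx.
- exact: metric_sym.
- exact: metric_triangle.
Qed.

(** Since [X] is unbounded, the restriction [r < diam] in regularity disappears. *)
Lemma flat_ahlfors (R : realType) (n : nat) (T : Type) (d : T -> T -> R) (delta s0 C : R) :
  is_metric d -> reifenberg_flat n.+1 d delta s0 -> 0 < delta -> 0 < s0 -> delta <= 40^-1 ->
  ahlfors_regular d n.+1 C -> forall x r, 0 < r ->
  ((C^-1 * r ^+ n.+1)%:E <= hausdorff_measure d n.+1 (cball d x r))%E /\
  (hausdorff_measure d n.+1 (cball d x r) <= (C * r ^+ n.+1)%:E)%E.
Proof.
move=> d_met flat delta0 s00 del [_ reg] x r r0; apply: reg => //.
have sD : s0 < 2 * (r + s0) + 2 by lra.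
have [e eD _] := flat_far d_met flat delta0 s00 x del sD.
apply: (@lt_le_trans _ _ (d x e)%:E); first by rewrite lte_fin; lra.
by rewrite /diam le_max; apply/orP; right; apply: ereal_sup_ubound; exists (x, e).
Qed.

Definition tube_constant (R : realType) (n : nat) (C : R) : R :=
  Num.max 1 (Num.max (tube_upper_constant n C) (tube_lower_constant n C)^-1).

Lemma tube_ahlfors (R : realType) (n : nat) (T : Type) (rho : T -> T -> R) (C : R) :
  1 <= C ->
  (forall u t, 0 < t ->
    ((tube_lower_constant n C * t ^+ n)%:E <= hausdorff_measure rho n (cball rho u t))%E /\
    (hausdorff_measure rho n (cball rho u t) <= (tube_upper_constant n C * t ^+ n)%:E)%E) ->
  ahlfors_regular rho n (tube_constant n C).
Proof.
move=> C1 reg; have K1 : 1 <= tube_constant n C by rewrite le_max lexx.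
split=> // u t t0 _; have [lo up] := reg u t t0.
have tn : 0 < t ^+ n by rewrite exprn_gt0.
have l0 : 0 < tube_lower_constant n C.
  apply: divr_gt0; first exact: hausdorff_lower_constant_gt0.
  by rewrite mulr_gt0 ?exprn_gt0//; lra.
split.
  apply: le_trans lo; rewrite lee_fin ler_pM2r// -[leRHS]invrK lef_pV2 ?posrE ?invr_gt0//.
    by rewrite !le_max lexx !orbT.
  by lra.
by apply: le_trans up _; rewrite lee_fin ler_pM2r// !le_max lexx orbT.
Qed.

Theorem theorem3 (R : realType) (n : nat) (hn : (1 <= n)%N) :
  exists K : R -> R,
  forall eps : R, 0 < eps ->
  exists2 delta : R, 0 < delta &
  forall (X : metricType R) (s0 : R), 0 < s0 ->
  reifenberg_flat n (@mdist R X) delta s0 ->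
  forall (x : X) (r : R), 0 < r ->
  exists (rho : 'rV[R]_n -> 'rV[R]_n -> R) (g : X -> 'rV[R]_n),
    [/\ is_metric rho,
        bi_holder_equivalent_to_norm rho euclidean_norm &
        set_fun (cball (@mdist R X) x r) (cball rho 0 (2 * r)) g] /\
    [/\ forall y z : X, cball (@mdist R X) x r y -> cball (@mdist R X) x r z ->
          `|rho (g y) (g z) - mdist y z| <= eps * (mdist y z + s0),
        (ereal_sup [set ereal_inf [set (rho u v)%:E
                                  | v in g @` cball (@mdist R X) x r]
                   | u in cball rho 0%R ((1 - eps) * r)%R] <= (eps * s0)%:E)%E &
        forall C : R, ahlfors_regular (@mdist R X) n C ->
          ahlfors_regular rho n (K C)].
Proof.
case: n hn => [//|n] _.
exists (tube_constant n.+1) => eps eps0.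
(* The square is there for radii comparable to [eps * s0], where [b] must be small with respect to
   [eps * r], of order [eps ^+ 2 * s0]. *)
pose e1 := Num.min eps 1; pose q := e1 * e1.
have e10 : 0 < e1 by rewrite lt_min eps0/=.
have e1e : e1 <= eps by rewrite ge_min lexx.
have e11 : e1 <= 1 by rewrite ge_min lexx orbT.
have q0 : 0 < q by exact: mulr_gt0.
have qe1 : q <= e1 by rewrite -[leRHS]mulr1 ler_pM2l.
have qee : q <= eps * eps by rewrite ler_pM ?(ltW e10).
clearbody q.
(* Chosen so that [80 * delta * s0 = b / 2] for [b = q * s0 / 100]. *)
pose delta := q / 100 / 160.
have delta0 : 0 < delta by apply: divr_gt0 => //; exact: divr_gt0.
have del : delta <= 40^-1 by rewrite /delta; lra.
have dq : 80 * delta = q / 200 by rewrite /delta; field.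
clearbody delta; exists delta => // X s0 s00 flat x r r0.
set d := @mdist R X in flat *.
have d_met : is_metric d := mdist_metric X.
have [d0 dE dC dD] := d_met.
(* Errors are at most [34 * b], to be compared with [eps * s0 >= 100 * b] and,
   when [r >= eps * s0 / 4], with [eps * r >= 25 * b]. *)
pose b := q * s0 / 100.
have qs0 : 0 < q * s0 by exact: mulr_gt0.
have b0 : 0 < b by exact: divr_gt0.
have qsb : q * s0 = 100 * b by rewrite /b; field.
have b20 : 0 < b / 2 by exact: divr_gt0.
have db2 : 80 * delta * s0 <= b / 2 by rewrite dq /b; lra.
clearbody b; clear dq.
have qs1 : q * s0 <= s0 by rewrite -[leRHS]mul1r ler_pM2r//; lra.
have es100 : q * s0 <= eps * s0 by rewrite ler_pM2r//; lra.
have ees : q * s0 <= eps * eps * s0 by rewrite ler_pM2r.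
rewrite qsb in qs0 qs1 es100 ees; clear qsb.
have bs40 : 40 * b <= s0 by lra.
have bs : b <= s0 by lra.
have b2s : b / 2 <= s0 by lra.
have db : 80 * delta * s0 <= b by lra.
have es80 : 80 * b <= eps * s0 by lra.
have er rs : eps * s0 / 4 <= rs -> 25 * b <= eps * rs.
  move=> h; have : eps * (eps * s0 / 4) <= eps * rs by rewrite ler_pM2l.
  have -> : eps * (eps * s0 / 4) = eps * eps * s0 / 4 by ring.
  lra.
clear e1 e10 e1e e11 q q0 qe1 qee qs0 qs1 es100 ees.
have mid := flat_midpoint d_met flat delta0 s00 b0 bs db.
have cov := flat_cover d_met flat delta0 s00 b20 b2s db2.
clear db db2 b20 b2s.
(* A point at distance at least [D / 2 = r + s0] from [x] remains outside the ball of radius [r]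
   after both ends of the walk are moved by [4 * b] to net points. *)
pose D := 2 * r + 2 * s0.
have [k kD] := scale_unbounded b0 D.
have kD' : D <= scale b k.+1.
  by apply: le_trans kD _; rewrite scaleS; have := scale_ge b0 k; lra.
have [F [uF Fsep Fnet Fx [Fball Fconn]]] := @exists_domain_net R X d b k.+1 x d_met b0 isT mid cov.
clear mid cov kD.
have dxx : d x x = 0 by exact/dE.
have [x0 x0F x0x] : exists2 f, f \in F & d f x <= 4 * b.
  by apply: Fnet; rewrite dxx (le_trans (ltW b0))// scale_ge.
have sD : s0 < D by rewrite /D; lra.
have [e eD1 eD2] := flat_far d_met flat delta0 s00 x del sD.
have [f fF fe] := Fnet e (le_trans eD2 kD').
have x0f : r < d x0 f.
  have := dD x x0 e; have := dD x0 f e; rewrite [d x x0]dC; move: eD1; rewrite /D; lra.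
pose step : rel X := fun p z => d p z <= 10 * b.
have [|||W [pW lW WF Wmult]] := @covering_walk X step _ _ F x0 f uF x0F fF _.
- by move=> p z; rewrite /step dC.
- by move=> p; rewrite /step (proj2 (dE p p) erefl) mulr_ge0// ltW.
- by move=> V VF fV nall; exact: (Fconn V f VF fV nall).
have W0 : (0 < size W)%N.
  case: W lW {pW WF Wmult} => // lW; exfalso; move: x0f; rewrite -lW /=.
  by rewrite (proj2 (dE _ _) erefl) => /(lt_trans r0); rewrite ltxx.
have sg0 : 0 < 10 * b by lra.
pose rho : 'rV[R]_n.+1 -> 'rV[R]_n.+1 -> R := tube_dist d (10 * b) x0 W.
pose a : 'I_(size W).+1 -> 'rV[R]_n.+1 := @tube_mark R n X (10 * b) W.
pose w i : X := @tube_label X x0 W i.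
have rho_met : is_metric rho := tube_metric d_met sg0 W0 pW.
have [rho0 rhoE rhoC rhoD] := rho_met.
have up i j : rho (a i) (a j) <= 10 * b + d (w i) (w j) := tube_mark_le d x0 sg0 W0 i j.
have lo i j : d (w i) (w j) <= rho (a i) (a j) := tube_mark_ge d_met sg0 W0 pW i j.
have a0 : a ord0 = 0 := tube_mark0 (10 * b) W.
have w0 : w ord0 = x0 by [].
suff [g [gfun gdist gdense]] : exists g : X -> 'rV[R]_n.+1,
    [/\ set_fun (cball d x r) (cball rho 0 (2 * r)) g,
        forall y z, d x y <= r -> d x z <= r ->
          `|rho (g y) (g z) - d y z| <= eps * (d y z + s0) &
        forall u, rho 0 u <= (1 - eps) * r ->
          exists2 y, d x y <= r & rho u (g y) <= eps * s0].
  exists rho, g; split; first by split=> //; exact: tube_bi_holder.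
  split=> //.
    apply: ge_ereal_sup => _ [u uB <-]; have [y xy uy] := gdense u uB.
    by apply: ge_ereal_inf; exists (rho u (g y))%:E; [exists (g y) => //; exists y|].
  move=> C reg; have C1 := reg.1; have reg' := flat_ahlfors d_met flat delta0 s00 del reg.
  have Fdiam p z : p \in F -> z \in F -> d p z <= 8 * scale b k.+1.
    move=> /Fx px /Fx zx; have := dD p x z; rewrite [d p x]dC; lra.
  apply: tube_ahlfors => // u t t0; split.
    exact: (tube_lower d_met sg0 W0 pW b0 erefl C1 (ltn0Sn k) uF WF Fsep Fdiam Fball reg').
  exact: (tube_upper d_met sg0 W0 pW b0 erefl C1 uF WF Fsep Wmult reg').
clear Fsep Fball Fconn Fx Wmult del delta0 flat.
have es0 : 0 < eps * s0 by exact: mulr_gt0.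
have [rs|rs] := ltP r (eps * s0 / 4).
  (* The whole ball has diameter at most [2 * r < eps * s0 / 2], so a constant map is precise
     enough. *)
  exists (fun=> 0); split=> [y _|y z xy xz|u uB].
  - by rewrite /cball /= (proj2 (rhoE _ _) erefl) mulr_ge0// ltW.
  - rewrite (proj2 (rhoE _ _) erefl) sub0r normrN ger0_norm//.
    have := dD y x z; rewrite [d y x]dC mulrDr; have : 0 <= eps * d y z by rewrite mulr_ge0// ltW.
    lra.
  exists x; first by rewrite dxx ltW.
  rewrite rhoC; apply: le_trans uB _; have : 0 < eps * r by exact: mulr_gt0.
  lra.
have {}er := er r rs.
have near y : exists i, d x y <= r -> d (w i) y <= 4 * b.
  have [xy|] := leP (d x y) r; last by exists ord0.
  have [|h hF hy] := Fnet y; first by apply: le_trans kD'; rewrite /D; lra.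
  have hW : (index h (x0 :: W) < (size W).+1)%N by rewrite -[X in (_ < X)%N]/(size (x0 :: W)) index_mem WF.
  by exists (Ordinal hW) => _; rewrite /w /tube_label nth_index ?WF.
have [I IP] := choice near.
(* The error is [4 * b] at each end plus the cost [10 * b] of a shortcut; the image lies in the ball
   of radius [2 * r] because [r >= eps * s0 / 4 >= 20 * b]. *)
exists (fun y => a (I y)); split=> [y xy|y z xy xz|u uB].
- rewrite /cball /= -a0; have := up ord0 (I y); rewrite w0; have := IP y xy.
  have := dD x0 x (w (I y)); have := dD x y (w (I y)); rewrite [d y _]dC.
  by move: xy; rewrite /cball /=; lra.
- have := up (I y) (I z); have := lo (I y) (I z); have := IP y xy; have := IP z xz.
  have := dD (w (I y)) y (w (I z)); have := dD y z (w (I z)); rewrite [d z (w _)]dC.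
  have := dD y (w (I y)) z; have := dD (w (I y)) (w (I z)) z; rewrite [d y (w _)]dC.
  have : 0 <= eps * d y z by rewrite mulr_ge0// ltW.
  by rewrite mulrDr ler_norml => *; apply/andP; split; lra.
have [Lu|uL] := leP (tube_length (10 * b) W) `|u|.
  have := tube_exit d_met sg0 W0 pW Lu; rewrite lW => /le_trans/(_ uB) h.
  exfalso; have : 0 < eps * r by exact: mulr_gt0.
  lra.
have [i ui] := tube_near_mark sg0 W0 (ltW uL).
have rui : rho u (a i) <= 2 * (10 * b) by apply: le_trans ui; exact: tube_le.
(* The shift from [x] to [x0] and the distance from [u] to the mark cost [24 * b], less than the
   margin [eps * r]. *)
have xw : d x (w i) <= r.
  have := dD x x0 (w i); rewrite [d x x0]dC; have := lo ord0 i; rewrite w0 a0.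
  have := rhoD 0 u (a i); lra.
exists (w i) => //; have := up i (I (w i)); have := IP _ xw; rewrite [d (w _) (w i)]dC.
have := rhoD u (a i) (a (I (w i))); lra.
Qed.
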